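(* Let $d\ge1$, let $B$ be a $d\times d$ matrix with integer entries and $\det B\neq0$, let $b\in\mathbb R^d$, and let $T:\mathbb T^d\to\mathbb T^d$ be the affine map $Tx=Bx+b \bmod \mathbb Z^d$. Suppose that $T$ has positive topological entropy. Then $(\mathbb T^d,T)$ is Bohr chaotic. Actually, for every non-trivial weight $(w_n)_{n\ge0}$ there exists $f\in C(\mathbb T^d)$ such that the set of $x\in\mathbb T^d$ satisfying $$\limsup_{N\to\infty}\frac1N\left|\sum_{n=0}^{N-1}w_nf(T^nx)\right|>0$$ has Hausdorff dimension $d$.
   Context: $\mathbb T^d=\mathbb R^d/\mathbb Z^d$; $C(X)$ is the space of continuous complex-valued functions on a compact space $X$. A (non-trivial) weight is a bounded sequence of complex numbers $(w_n)_{n\ge 0}$ with $\limsup_{N\to\infty}\frac1N\sum_{n=0}^{N-1}|w_n|>0$. A topological dynamical system $(X,T)$ ($X$ compact metric, $T$ continuous) is Bohr chaotic if for every non-trivial weight $(w_n)_{n\ge0}$ there exist $f\in C(X)$ and $x\in X$ such that $\limsup_{N\to\infty}\frac1N\left|\sum_{n=0}^{N-1}w_nf(T^nx)\right|>0$. *)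

(* Defs.v *)
From HB Require Import structures.
From mathcomp Require Import all_boot all_order all_algebra.
From mathcomp Require Import generic_quotient finmap.
From mathcomp Require Import all_classical all_reals all_analysis.
From mathcomp Require Import complex.
Set Implicit Arguments.
Unset Strict Implicit.
Unset Printing Implicit Defensive.
Import Order.TTheory GRing.Theory Num.Theory.
Import numFieldNormedType.Exports.
Local Open Scope classical_set_scope.
Local Open Scope ring_scope.
Local Open Scope complex_scope.
Local Open Scope quotient_scope.

Section TorusType.
Variables (R : realType) (d : nat).
Implicit Types u v w : 'cV[R]_d.

Definition torus_rel u v : bool := [forall i, u i 0 - v i 0 \is a Num.int].

Lemma torus_rel_equiv : equiv_class_of torus_rel.
Proof.
split.
- by move=> u; apply/forallP => i; rewrite subrr rpred0.
- by move=> u v; apply: eq_forallb => i; rewrite -opprB rpredN.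
- move=> v u w /forallP uv /forallP vw; apply/forallP => i.
  by rewrite -(subrKA (v i 0)) rpredD.
Qed.

Canonical torus_equiv := EquivRelPack torus_rel_equiv.

Definition torus : Type := {eq_quot torus_equiv}.
HB.instance Definition _ := Choice.on torus.
HB.instance Definition _ := EqQuotient.on torus.

Implicit Types x y z : torus.

Lemma torus_piP u v :
  reflect (\pi_torus u = \pi_torus v) [forall i, u i 0 - v i 0 \is a Num.int].
Proof. by rewrite -[X in reflect _ X]/(torus_equiv u v); exact/eqmodP. Qed.

Definition torus_dists x y : set R :=
  [set `|u - v| | u in [set u | \pi_torus u = x]
                & v in [set v | \pi_torus v = y]].

(* `|u| is the sup norm of R^d; another norm would give a bi-Lipschitz
   equivalent distance, hence the same entropy and Hausdorff dimension. *)
Definition torus_dist x y : R := inf (torus_dists x y).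

Lemma torus_dists_lb x y : lbound (torus_dists x y) 0.
Proof. by move=> _ [u _ [v _ <-]]. Qed.

Lemma torus_distsP x y : has_inf (torus_dists x y).
Proof.
split; last by exists 0; exact: torus_dists_lb.
by exists `|repr x - repr y|, (repr x); rewrite /= ?reprK//;
  exists (repr y); rewrite /= ?reprK.
Qed.

Lemma torus_dist_ge0 x y : 0 <= torus_dist x y.
Proof.
by apply: lb_le_inf; [case: (torus_distsP x y) | exact: torus_dists_lb].
Qed.

Lemma torus_dist_pi u v : torus_dist (\pi u) (\pi v) <= `|u - v|.
Proof.
apply: ge_inf; first by case: (torus_distsP (\pi u) (\pi v)).
by exists u => //; exists v.
Qed.

(* The left representative can be prescribed, by invariance of the norm under
   integer translations of both arguments. *)
Lemma torus_dist_lt u y e : torus_dist (\pi u) y < e ->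
  exists2 v, \pi_torus v = y & `|u - v| < e.
Proof.
move=> de; have e0 : 0 < e - torus_dist (\pi u) y by rewrite subr_gt0.
have [_ [u' uu' [v' vy <-]]] := inf_adherent e0 (torus_distsP (\pi u) y).
rewrite -/(torus_dist _ _) subrKC => lte.
exists (v' + (u - u')); last by rewrite opprD addrA addrAC opprB subrKC.
rewrite -vy; apply/torus_piP; apply/forallP => i.
rewrite !mxE addrAC subrr add0r.
by move: uu' => /esym/torus_piP/forallP/(_ i).
Qed.

Lemma torus_distxx x : torus_dist x x = 0.
Proof.
apply/eqP; rewrite eq_le torus_dist_ge0 andbT -(reprK x).
by rewrite (le_trans (torus_dist_pi _ _))// subrr normr0.
Qed.

Lemma torus_dist_sym x y : torus_dist x y = torus_dist y x.
Proof.
congr inf; apply/seteqP; split => _ [u ux [v vy <-]];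
  by exists v => //; exists u => //; rewrite distrC.
Qed.

Lemma torus_dist_triangle y x z :
  torus_dist x z <= torus_dist x y + torus_dist y z.
Proof.
apply/ler_addgt0Pl => e e0; rewrite [e]splitr.
have e20 : 0 < e / 2 by rewrite divr_gt0.
have [|v vy uv] := @torus_dist_lt (repr x) y (torus_dist x y + e / 2).
  by rewrite reprK ltrDl.
have [|w wz vw] := @torus_dist_lt v z (torus_dist y z + e / 2).
  by rewrite vy ltrDl.
rewrite -{1}(reprK x) -wz (le_trans (torus_dist_pi _ _))//.
rewrite -(subrKA v) (le_trans (ler_normD _ _))//.
rewrite [leRHS]addrC addrACA; apply: lerD.
  exact: ltW.
by rewrite wz; exact: ltW.
Qed.

Lemma mx_coord_le u i : `|u i 0| <= `|u|.
Proof.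
by rewrite [leRHS]mx_normrE (le_trans _ (le_bigmax _ _ (i, 0))).
Qed.

Lemma torus_dist_eq0 x y : torus_dist x y = 0 -> x = y.
Proof.
move=> xy0.
have [|v vy uv] := @torus_dist_lt (repr x) y (1 / 2).
  by rewrite reprK xy0 divr_gt0.
rewrite -(reprK x) -vy; congr (\pi _); apply/eqP; rewrite -subr_eq0.
rewrite -normr_le0; apply/ler_addgt0Pl => e e0; rewrite addr0.
have [|v' v'y uv'] := @torus_dist_lt (repr x) y (Num.min (1 / 2) e).
  by rewrite reprK xy0 lt_min e0 divr_gt0.
move: uv'; rewrite lt_min => /andP[uv'2 uv'e].
suff -> : v = v' by rewrite ltW.
have /torus_piP/forallP vv' : \pi_torus v = \pi_torus v' by rewrite vy v'y.
apply/colP => i; apply/eqP; rewrite -subr_eq0.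
apply/negPn/negP => /(norm_intr_ge1 (vv' i)); apply/negP; rewrite -ltNge.
have -> : v i 0 - v' i 0 = (v - v') i 0 by rewrite !mxE.
rewrite (le_lt_trans (mx_coord_le _ _))// -(subrKA (repr x)).
by rewrite (le_lt_trans (ler_normD _ _))// [ltRHS]splitr ltrD// distrC.
Qed.

HB.instance Definition _ := isMetric.Build R torus
  torus_distxx torus_dist_eq0 torus_dist_sym torus_dist_triangle.

(* The topology of the distance is the quotient topology of R^d / Z^d. *)
Lemma torus_openP (U : set torus) : open U <-> open (\pi_torus @^-1` U).
Proof.
rewrite !openE; split=> [oU u /= Uu|oU x Ux].
- have := oU _ Uu; rewrite /interior -!nbhs_ballE => -[e /= e0 eU].
  exists e => //= v; rewrite mx_norm_ball /ball_ /= => uv; apply: eU.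
  by rewrite ballEmdist /= (le_lt_trans (torus_dist_pi _ _)).
- have /oU : (\pi_torus @^-1` U) (repr x) by rewrite /= reprK.
  rewrite /interior -!nbhs_ballE => -[e /= e0 eU]; exists e => //= y.
  rewrite ballEmdist /= -{1}(reprK x) => /torus_dist_lt[v <- uv].
  by apply: eU; rewrite mx_norm_ball.
Qed.

Lemma torus_compact : compact [set: torus].
Proof.
pose p (w : 'rV[R]_d) : torus := \pi w^T.
have cp : continuous p.
  apply/continuousP => U /torus_openP; rewrite !openE => oU w /= Uw.
  have := oU _ Uw; rewrite /interior -!nbhs_ballE => -[e /= e0 eU].
  exists e => //= v wv; apply: eU.
  by case: wv => _ wv; split=> // i j; rewrite !mxE.
have -> : [set: torus] = p @` [set w : 'rV[R]_d | forall i, (`[0, 1]%classic : set R) (w 0 i)].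
  apply/seteqP; split=> // x _.
  exists (\row_i (repr x i 0 - (Num.floor (repr x i 0))%:~R)).
    move=> i; rewrite mxE /= in_itv /= subr_ge0 floor_le.
    by rewrite lerBlDl -[1]/(1%:~R) -intrD ltW // floorD1_gt.
  rewrite /p -[RHS]reprK; apply/torus_piP/forallP => i.
  by rewrite !mxE addrAC subrr add0r rpredN intr_int.
apply: continuous_compact; first exact: continuous_subspaceT.
by apply: (@rV_compact R d (fun=> `[0, 1]%classic)) => i; exact: segment_compact.
Qed.

(* Defined on representatives; independence of the representative, which uses
   that B is integral, is [torus_affineE]. *)
Definition torus_affine (B : 'M[int]_d) (b : 'cV[R]_d) (x : torus) : torus :=
  \pi_torus (map_mx intr B *m repr x + b).

Lemma torus_affineE B b u :
  torus_affine B b (\pi u) = \pi_torus (map_mx intr B *m u + b).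
Proof.
apply/torus_piP/forallP => i.
have /torus_piP/forallP ur : \pi_torus (repr (\pi_torus u)) = \pi_torus u.
  by rewrite reprK.
rewrite !mxE opprD addrACA subrr addr0 -sumrB rpred_sum // => j _.
by rewrite -mulrBr rpredM // mxE intr_int.
Qed.

Lemma mulmx_norm_le m (A : 'M[R]_(m, d)) :
  exists2 C, 0 < C & forall u, `|A *m u| <= C * `|u|.
Proof.
exists (1 + \sum_i \sum_j `|A i j|) => [|u].
  by rewrite ltr_pwDl // sumr_ge0 // => i _; rewrite sumr_ge0.
rewrite [leLHS]mx_normrE; apply/bigmax_leP; split=> [|[i k] _ /=].
  by rewrite mulr_ge0 // addr_ge0 // sumr_ge0 // => i _; rewrite sumr_ge0.
rewrite (ord1 k) mxE (le_trans (ler_norm_sum _ _ _)) //.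
apply: (@le_trans _ _ (\sum_j `|A i j| * `|u|)).
  by apply: ler_sum => j _; rewrite normrM ler_wpM2l // mx_coord_le.
rewrite -mulr_suml ler_wpM2r // (bigD1 i) //= addrCA lerDl addr_ge0 //.
by rewrite sumr_ge0 // => l _; rewrite sumr_ge0.
Qed.

Lemma torus_affine_continuous B b : continuous (torus_affine B b).
Proof.
have [C C0 BC] := mulmx_norm_le (map_mx intr B).
move=> x; apply/(@metricType_numDomainType.cvgrPdist_lt _ torus _ _ (nbhs_filter x)) => e e0.
rewrite near_simpl /= /prop_near1 -nbhs_ballE; exists (e / C) => /=.
  by rewrite divr_gt0.
move=> y; rewrite ballEmdist /= -{1 2}(reprK x) => /torus_dist_lt[v <- uv].
rewrite !torus_affineE (le_lt_trans (torus_dist_pi _ _)) //.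
rewrite opprD addrACA subrr addr0 -mulmxBr (le_lt_trans (BC _)) //.
by rewrite mulrC -ltr_pdivlMr.
Qed.

End TorusType.

Arguments torus_affine {R d} B b x.

Section Entropy.
Variables (R : realType) (X : metricType R) (T : X -> X).

Definition bowen_dist (n : nat) (x y : X) : R :=
  \big[Num.max/0]_(i < n) mdist (iter i T x) (iter i T y).

Definition separated (n : nat) (eps : R) (E : {fset X}) : Prop :=
  forall x y, x \in E -> y \in E -> x != y -> eps < bowen_dist n x y.

Definition separated_card (n : nat) (eps : R) : \bar R :=
  ereal_sup [set (#|` E|%:R)%:E | E in [set E | separated n eps E]].

Definition entropy_at (eps : R) : \bar R :=
  limn_esup (fun n => ((n%:R)^-1)%:E * lne (separated_card n eps))%E.

(* Bowen's definition. The limsup over n is nonincreasing in eps, so the limit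
   exists in [0, +oo]. *)
Definition topological_entropy : \bar R := lim (entropy_at eps @[eps --> 0^'+]).

End Entropy.

Section Hausdorff.
Variables (R : realType) (X : metricType R).
Local Open Scope ereal_scope.

Definition diameter (U : set X) : \bar R :=
  ereal_sup [set (mdist x y)%:E | x in U & y in U].

(* diam(U)^s, with the conventions that the empty set contributes 0 and that
   0^0 = 1, so that the 0-dimensional measure is the counting measure. *)
Definition diameter_pow (s : R) (U : set X) : \bar R :=
  if U == set0 then 0 else diameter U `^ s.

(* Countable covers by arbitrary sets; finite covers are padded by set0. *)
Definition delta_cover (delta : R) (A : set X) (U : nat -> set X) : Prop :=
  A `<=` \bigcup_i U i /\ forall i, diameter (U i) <= delta%:E.

Definition hausdorff_premeasure (s delta : R) (A : set X) : \bar R :=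
  ereal_inf [set \sum_(0 <= i <oo) diameter_pow s (U i)
            | U in delta_cover delta A].

Definition hausdorff_measure (s : R) (A : set X) : \bar R :=
  ereal_sup [set hausdorff_premeasure s delta A |
               delta in [set t : R | (0 < t)%R]].

Definition hausdorff_dim (A : set X) : \bar R :=
  ereal_inf [set s%:E |
               s in [set s : R | (0 <= s)%R /\ hausdorff_measure s A = 0]].

End Hausdorff.

Section BohrChaos.
Variable R : realType.

Local Notation normc := (@ComplexField.Normc.normc R).

Definition bounded_weight (w : nat -> R[i]) : Prop :=
  exists M : R, forall n, normc (w n) <= M.

Definition nontrivial_weight (w : nat -> R[i]) : Prop :=
  bounded_weight w /\
  (0 < limn_esup (fun N => ((N%:R)^-1 * \sum_(0 <= n < N) normc (w n))%:E))%E.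

Definition correlated (X : metricType R) (T : X -> X) (w : nat -> R[i])
    (f : X -> R[i]^o) (x : X) : Prop :=
  (0 < limn_esup (fun N =>
     ((N%:R)^-1 * normc (\sum_(0 <= n < N) w n * f (iter n T x)))%:E))%E.

(* [R[i]^o] is [R[i]] with the topology of its modulus. A system is a compact
   metric X with a continuous T; for the torus these are [torus_compact] and
   [torus_affine_continuous]. *)
Definition bohr_chaotic (X : metricType R) (T : X -> X) : Prop :=
  forall w, nontrivial_weight w ->
  exists f : X -> R[i]^o, continuous f /\ exists x, correlated T w f x.

End BohrChaos.

(* Main.v *)
(* If every eigenvalue of B had modulus at most 1, the powers of B would grow
   polynomially (Cayley-Hamilton) and the entropy would vanish; hence B has an
   eigenvector u with eigenvalue lam, |lam| > 1, normalised by u_i0 = 1.  Take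
   f(x) = exp(2 i pi x_i0), so that f(T^n x) = X_n(x) is a character of frequency
   eta_n = (B^T)^n e_i0 up to a unimodular constant.  The linear form <., u>
   maps eta_n to lam^n, so distinct small combinations of the eta_n never cancel.

   Choose a large q and a class r mod q that carries a positive part of the
   weight, and consider the Riesz product prod_j (1 + a Re (theta_j X_(r+qj)))
   with theta_j = w_(r+qj) / |w_(r+qj)|.  Under it X_n has mean a conj(theta_j) / 2
   if n = r + qj and 0 otherwise, and X_n, X_m are uncorrelated for
   |n - m| >= q.  By Chebyshev, sum_(n < N) w_n X_n is at least delta N outside
   a set of mass O(1/N), for infinitely many N.  Testing against Fejer kernels,
   a ball of radius rho has mass O(rho^sigma), where sigma < d is arbitrary
   provided a is small.  As f does not depend on a, the dimension is d.

   No limit measure is needed: by compactness only finitely many balls and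
   values of N are involved, and integrals of the corresponding trigonometric
   polynomials are averages over the grid (1/M) Z^d / Z^d for M large. *)
Require Import Defs.
From mathcomp Require Import all_boot all_order all_algebra.
From mathcomp Require Import generic_quotient finmap.
From mathcomp Require Import all_classical all_reals all_analysis.
From mathcomp Require Import complex ring lra zify.
Set Implicit Arguments.
Unset Strict Implicit.
Unset Printing Implicit Defensive.
Import Order.TTheory GRing.Theory Num.Theory.
Import numFieldNormedType.Exports.
Local Open Scope classical_set_scope.
Local Open Scope ring_scope.
Local Open Scope complex_scope.
Local Open Scope quotient_scope.

Local Notation normc := (@ComplexField.Normc.normc _).

(** * The modulus as a real-valued norm on complex numbers *)

Section ComplexNorm.
Variable R : realType.
Implicit Types (z w : R[i]) (x : R).

Lemma normcE_norm z : `|z| = (normc z)%:C.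
Proof. by case: z. Qed.

Lemma normc_ge0 z : 0 <= normc z.
Proof. by case: z => a b; exact: sqrtr_ge0. Qed.

Lemma normc_real x : normc x%:C = `|x|.
Proof. by rewrite /= expr0n addr0 sqrtr_sqr. Qed.

Lemma normc_conjc z : normc (conjc z) = normc z.
Proof. by case: z => a b /=; rewrite sqrrN. Qed.

Lemma real_complexM x y : (x * y)%:C = x%:C * y%:C.
Proof. exact: rmorphM. Qed.

Lemma conjcM z w : conjc (z * w) = conjc z * conjc w.
Proof. exact: rmorphM. Qed.

Lemma conjcB z w : conjc (z - w) = conjc z - conjc w.
Proof. exact: rmorphB. Qed.

Lemma conjc_sum (I : Type) (r : seq I) (F : I -> R[i]) :
  conjc (\sum_(i <- r) F i) = \sum_(i <- r) conjc (F i).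
Proof. exact: rmorph_sum. Qed.

Lemma ler_normcD z w : normc (z + w) <= normc z + normc w.
Proof. by rewrite -lecR rmorphD /= -!normcE_norm ler_normD. Qed.

Lemma ler_normcB z w : normc z - normc w <= normc (z - w).
Proof.
by rewrite lerBlDr (le_trans _ (ler_normcD _ _)) // subrK.
Qed.

Lemma normc_opp z : normc (- z) = normc z.
Proof. by case: z => a b /=; rewrite !sqrrN. Qed.

Lemma normc_sum (I : Type) (r : seq I) (P : pred I) (F : I -> R[i]) :
  normc (\sum_(i <- r | P i) F i) <= \sum_(i <- r | P i) normc (F i).
Proof.
elim/big_ind2: _ => // [|z x w y zx wy]; first by rewrite ComplexField.Normc.normc0.
by rewrite (le_trans (ler_normcD _ _)) // lerD.
Qed.

Lemma normc_sqr z : z * (conjc z) = (normc z ^+ 2)%:C.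
Proof. by rewrite rmorphXn /= -normcE_norm sqr_normc. Qed.

Lemma Re_le_normc z : complex.Re z <= normc z.
Proof.
case: z => a b /=; rewrite (le_trans (ler_norm _)) // -sqrtr_sqr ler_wsqrtr //.
by rewrite lerDl sqr_ge0.
Qed.

Lemma normc_le_ReIm z : normc z <= `|complex.Re z| + `|complex.Im z|.
Proof.
rewrite {1}(complexE z) (le_trans (ler_normcD _ _)) // ComplexField.Normc.normcM !normc_real.
have -> : normc ('i%C : R[i]) = 1 by rewrite /= expr0n expr1n add0r sqrtr1.
by rewrite mul1r.
Qed.

Lemma Re_sum (I : Type) (r : seq I) (F : I -> R[i]) :
  complex.Re (\sum_(i <- r) F i) = \sum_(i <- r) complex.Re (F i).
Proof.
elim: r => [|i r IH]; first by rewrite !big_nil.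
by rewrite !big_cons -IH; case: (F i) => u v; case: (\sum_(j <- r) F j).
Qed.

Lemma ReN_le_normc z : - complex.Re z <= normc z.
Proof. by rewrite -normc_opp; case: z => a b; exact: (Re_le_normc (- (a +i* b))). Qed.

End ComplexNorm.

(** * The character t -> exp(2 i pi t) of the line *)

Section UnitCharacter.
Variable R : realType.
Implicit Types s t : R.

Definition e1 t : R[i] := cos (2 * pi * t) +i* sin (2 * pi * t).

Lemma e1D s t : e1 (s + t) = e1 s * e1 t.
Proof.
rewrite /e1 mulrDr cosD sinD; apply/eqP; rewrite eq_complex /= eqxx /=.
by rewrite addrC.
Qed.

Lemma e1N t : e1 (- t) = (conjc (e1 t)).
Proof. by rewrite /e1 mulrN cosN sinN. Qed.

Lemma e1_0 : e1 0 = 1.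
Proof. by rewrite /e1 mulr0 cos0 sin0. Qed.

Lemma normc_e1 t : normc (e1 t) = 1.
Proof. by rewrite /= cos2Dsin2 sqrtr1. Qed.

Lemma e1_nat n : e1 n%:R = 1.
Proof.
elim: n => [|n IH]; first exact: e1_0.
rewrite -natr1 e1D IH mul1r /e1 mulr1 mulrC mulr_natr.
by rewrite cos2pi sin2pi.
Qed.

Lemma e1_int (k : int) : e1 k%:~R = 1.
Proof.
case: k => n; first exact: e1_nat.
by rewrite NegzE mulrNz e1N e1_nat; apply/eqP; rewrite eq_complex /= oppr0 !eqxx.
Qed.

Lemma e1_sum (I : Type) (r : seq I) (F : I -> R) :
  e1 (\sum_(i <- r) F i) = \prod_(i <- r) e1 (F i).
Proof.
by elim/big_ind2: _ => // [|s z t w <- <-]; [exact: e1_0 | exact: e1D].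
Qed.

Lemma e1_natX t n : e1 (t * n%:R) = e1 t ^+ n.
Proof.
elim: n => [|n IH]; first by rewrite mulr0 e1_0 expr0.
by rewrite -natr1 mulrDr mulr1 e1D IH exprSr.
Qed.

(** For 0 < t < 1 the real part is 1 - 2 sin(pi t)^2 < 1, and conjugation settles negative t. *)
Lemma e1_neq1 t : 0 < `|t| < 1 -> e1 t != 1.
Proof.
wlog t0 : t / 0 <= t => [hw|].
  have [t0|t0] := leP 0 t; first exact: hw.
  rewrite -normrN => h; have /hw := h; rewrite oppr_ge0 => /(_ (ltW t0)).
  apply: contra => /eqP e; rewrite e1N e; apply/eqP/eqP.
  by rewrite eq_complex /= oppr0 !eqxx.
rewrite ger0_norm // => /andP[tp t1].
rewrite eq_complex /= negb_and; apply/orP; left.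
have -> : 2 * pi * t = (pi * t) *+ 2 by rewrite mulr2n; ring.
rewrite cos_mulr2n cos2sin2.
have sp : 0 < sin (pi * t).
  by rewrite sin_gt0_pi // mulr_gt0 ?pi_gt0 //= gtr_pMr ?pi_gt0.
have : 0 < sin (pi * t) ^+ 2 by rewrite exprn_gt0.
by move=> h; rewrite lt_eqF // mulr2n; lra.
Qed.

(** With x = 2 pi t and |x| <= pi / 4, cos(2x) >= 0 means cos(x)^2 >= 1/2, and cos x >= cos(x)^2
    because 0 <= cos x <= 1. *)
Lemma Re_e1_ge t : `|t| <= 8^-1 -> 2^-1 <= complex.Re (e1 t).
Proof.
move=> t8 /=; set x := 2 * pi * t.
have p0 := pi_gt0 R.
have xb : `|x| <= pi / 4.
  rewrite /x !normrM normr_nat (gtr0_norm p0).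
  have -> : pi / 4 = 2 * pi * 8^-1 :> R by field.
  by rewrite ler_wpM2l // mulr_ge0 // ltW.
have /andP[x1 x2] : - (pi / 4) <= x <= pi / 4 by rewrite -ler_norml.
have c0 : 0 <= cos x by apply: cos_ge0_pihalf; apply/andP; split; lra.
have c2 : 0 <= cos (x *+ 2).
  by apply: cos_ge0_pihalf; rewrite [x *+ 2]mulr2n; apply/andP; split; lra.
have c1 := cos_le1 x.
move: c2; rewrite cos_mulr2n [_ ^+ 2 *+ 2]mulr2n expr2 => c2.
have : cos x * cos x <= cos x * 1 by rewrite ler_wpM2l.
lra.
Qed.

End UnitCharacter.

(** * Integer frequencies and the characters of the torus *)

Section Characters.
Variables (R : realType) (d : nat).
Implicit Types (x y : 'cV[R]_d) (k l : 'cV[int]_d).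

Definition pairing k x : R := \sum_i (k i 0)%:~R * x i 0.

Definition chr k x : R[i] := e1 (pairing k x).

Lemma pairingDl k l x : pairing (k + l) x = pairing k x + pairing l x.
Proof.
by rewrite -big_split /=; apply: eq_bigr => i _; rewrite mxE rmorphD mulrDl.
Qed.

Lemma pairingNl k x : pairing (- k) x = - pairing k x.
Proof. by rewrite -sumrN; apply: eq_bigr => i _; rewrite mxE rmorphN mulNr. Qed.

Lemma pairingDr k x y : pairing k (x + y) = pairing k x + pairing k y.
Proof. by rewrite -big_split /=; apply: eq_bigr => i _; rewrite mxE mulrDr. Qed.

Lemma pairing0l x : pairing 0 x = 0.
Proof. by rewrite /pairing big1 // => i _; rewrite mxE mul0r. Qed.

Lemma pairing_mul (B : 'M[int]_d) k x :
  pairing k (map_mx intr B *m x) = pairing (B^T *m k) x.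
Proof.
rewrite /pairing.
under eq_bigr do rewrite mxE mulr_sumr.
rewrite exchange_big /=; apply: eq_bigr => j _.
rewrite mxE rmorph_sum /= mulr_suml; apply: eq_bigr => i _.
by rewrite !mxE rmorphM /= mulrA [_%:~R * _%:~R]mulrC.
Qed.

Lemma chrD k l x : chr (k + l) x = chr k x * chr l x.
Proof. by rewrite /chr pairingDl e1D. Qed.

Lemma chrN k x : chr (- k) x = (conjc (chr k x)).
Proof. by rewrite /chr pairingNl e1N. Qed.

Lemma chr0 x : chr 0 x = 1.
Proof. by rewrite /chr pairing0l e1_0. Qed.

Lemma normc_chr k x : normc (chr k x) = 1.
Proof. exact: normc_e1. Qed.

Lemma chr_pi k x y : \pi_(torus R d) x = \pi_(torus R d) y -> chr k x = chr k y.
Proof.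
move=> /torus_piP/forallP xy.
have -> : x = y + (x - y) by rewrite addrC subrK.
rewrite /chr pairingDr e1D.
suff -> : e1 (pairing k (x - y)) = 1 by rewrite mulr1.
rewrite e1_sum big1 // => i _.
have /intrP[m hm] : (k i 0)%:~R * (x - y) i 0 \is a Num.int.
  by rewrite rpredM ?intr_int // !mxE xy.
by rewrite hm e1_int.
Qed.

End Characters.

(** * Averages over the grid (1/M) Z^d / Z^d *)

Section GridMean.
Variables (R : realType) (d M : nat).
Hypothesis M0 : (0 < M)%N.

Definition grid_point (g : {ffun 'I_d -> 'I_M}) : 'cV[R]_d :=
  \col_i ((g i)%:R / M%:R).

(** The field is a parameter because real functions (positivity) and complex ones (Fourier
    coefficients) are both averaged. *)
Definition grid_mean (K : fieldType) (F : 'cV[R]_d -> K) : K :=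
  (M%:R ^+ d)^-1 * \sum_g F (grid_point g).

Lemma eq_grid_mean (K : fieldType) (F G : 'cV[R]_d -> K) :
  F =1 G -> grid_mean F = grid_mean G.
Proof. by move=> FG; congr (_ * _); apply: eq_bigr. Qed.

Lemma grid_meanD (K : fieldType) (F G : 'cV[R]_d -> K) :
  grid_mean (fun x => F x + G x) = grid_mean F + grid_mean G.
Proof. by rewrite /grid_mean big_split mulrDr. Qed.

Lemma grid_meanZ (K : fieldType) (c : K) (F : 'cV[R]_d -> K) :
  grid_mean (fun x => c * F x) = c * grid_mean F.
Proof. by rewrite /grid_mean -mulr_sumr mulrCA. Qed.

Lemma grid_mean_sum (K : fieldType) (I : Type) (r : seq I) (F : I -> 'cV[R]_d -> K) :
  grid_mean (fun x => \sum_(i <- r) F i x) = \sum_(i <- r) grid_mean (F i).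
Proof. by rewrite /grid_mean exchange_big /= mulr_sumr. Qed.

Lemma grid_mean_real (F : 'cV[R]_d -> R) :
  grid_mean (fun x => (F x)%:C) = (grid_mean F)%:C.
Proof.
by rewrite /grid_mean rmorphM /= fmorphV rmorphXn rmorph_nat rmorph_sum.
Qed.

Lemma ler_grid_mean (F G : 'cV[R]_d -> R) :
  (forall x, F x <= G x) -> grid_mean F <= grid_mean G.
Proof.
move=> FG; rewrite ler_wpM2l ?invr_ge0 ?exprn_ge0 //.
by apply: ler_sum => g _; exact: FG.
Qed.

Lemma normc_grid_mean (F : 'cV[R]_d -> R[i]) :
  normc (grid_mean F) <= grid_mean (fun x => normc (F x)).
Proof.
have p0 : 0 <= (M%:R ^+ d : R)^-1 by rewrite invr_ge0 exprn_ge0.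
have -> : grid_mean F = ((M%:R ^+ d)^-1)%:C * \sum_g F (grid_point g).
  by rewrite fmorphV rmorphXn rmorph_nat.
rewrite ComplexField.Normc.normcM normc_real ger0_norm // ler_wpM2l //.
exact: normc_sum.
Qed.

(** The sum over the grid is a product of geometric sums, one per coordinate. Where k_i is nonzero,
    the bound |k_i| < M makes the ratio an M-th root of unity other than 1, so that factor
    vanishes. *)
Lemma grid_mean_chr (k : 'cV[int]_d) : k != 0 -> (forall i, `|k i 0| < M%:Z) ->
  grid_mean (chr k) = 0.
Proof.
move=> k0 kM; rewrite /grid_mean.
suff -> : \sum_g chr k (grid_point g) = 0 :> R[i] by rewrite mulr0.
pose w i : R[i] := e1 ((k i 0)%:~R / M%:R).
transitivity (\sum_(g : {ffun 'I_d -> 'I_M}) \prod_i w i ^+ g i).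
  apply: eq_bigr => g _; rewrite /chr e1_sum; apply: eq_bigr => i _.
  by rewrite -e1_natX mxE; congr e1; rewrite mulrAC mulrA.
rewrite -(bigA_distr_bigA (fun i (j : 'I_M) => w i ^+ j)) /=.
have [i ki] : exists i, k i 0 != 0.
  apply/existsP; apply: contraR k0 => /existsPn h.
  by apply/eqP/colP => i; rewrite mxE; apply/eqP; move: (h i); rewrite negbK.
apply/eqP/prodf_eq0; exists i => //.
have Mr : 0 < M%:R :> R by rewrite ltr0n.
have w1 : w i != 1.
  apply: e1_neq1; rewrite normrM normfV normr_nat divr_gt0 //=; last first.
    by rewrite normr_gt0 intr_eq0.
  rewrite ltr_pdivrMr // mul1r -intr_norm.
  by have := kM i; rewrite -(ltr_int R).
have wM : w i ^+ M = 1 by rewrite -e1_natX divfK ?e1_int // gt_eqF.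
have := subrX1 (w i) M; rewrite wM subrr => /esym/eqP.
by rewrite mulf_eq0 subr_eq0 (negbTE w1).
Qed.

Lemma grid_mean1 (K : numFieldType) : grid_mean (fun=> 1 : K) = 1.
Proof.
rewrite /grid_mean sumr_const card_ffun !card_ord -natrX mulVf //.
by rewrite pnatr_eq0 -lt0n expn_gt0 M0.
Qed.

End GridMean.

(** * Riesz products along a lacunary sequence of frequencies *)

Section RieszProduct.
Variables (R : realType) (d : nat).
(** Abstract version of the modulus of the linear form <., u>: the Riesz product sees the
    eigenvector u only through this subadditive size. *)
Variable size : 'cV[int]_d -> R.
Hypothesis size0 : size 0 = 0.
Hypothesis sizeN : forall k, size (- k) = size k.
Hypothesis sizeD : forall k l, size (k + l) <= size k + size l.
Hypothesis size_double : forall k, size (k + k) = 2 * size k.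

Variables (M T H Nmax : nat).
Hypothesis M0 : (0 < M)%N.
Hypothesis THM : (T * H < M)%N.
Local Notation E := (grid_mean M).

Definition bounded_freq (S : nat) (k : 'cV[int]_d) := forall i, `|k i 0| <= S%:Z.

Lemma bounded_freqD S1 S2 k l :
  bounded_freq S1 k -> bounded_freq S2 l -> bounded_freq (S1 + S2) (k + l).
Proof.
move=> h1 h2 i; rewrite mxE (le_trans (ler_normD _ _)) // PoszD.
by apply: lerD; [exact: h1 | exact: h2].
Qed.

Lemma bounded_freqN S k : bounded_freq S k -> bounded_freq S (- k).
Proof. by move=> h i; rewrite mxE normrN; exact: h. Qed.

Lemma bounded_freqW S1 S2 k : (S1 <= S2)%N -> bounded_freq S1 k -> bounded_freq S2 k.
Proof. by move=> h12 h1 i; rewrite (le_trans (h1 i)). Qed.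

(* [F] has no Fourier coefficient at a frequency of size larger than [rho].
   Aliasing on the grid is excluded by the budget [T]: the frequencies of [F]
   have entries at most [s * H], and [T * H < M]. *)
Definition spectrum (s : nat) (rho : R) (F : 'cV[R]_d -> R[i]) :=
  forall k t, (s + t <= T)%N -> bounded_freq (t * H) k -> rho < size k ->
  E (fun x => F x * chr k x) = 0.

Lemma spectrum_ext s rho F G : F =1 G -> spectrum s rho F -> spectrum s rho G.
Proof.
move=> FG sF k t st bk rk; rewrite -(sF k t st bk rk).
by apply: eq_grid_mean => x; rewrite FG.
Qed.

Lemma spectrumW s s' rho rho' F : (s <= s')%N -> rho <= rho' ->
  spectrum s rho F -> spectrum s' rho' F.
Proof.
move=> ss' rr sF k t st bk rk; apply: (sF k t) => //.
  by rewrite (leq_trans _ st) // leq_add2r.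
exact: le_lt_trans rr rk.
Qed.

Lemma spectrumD s rho F G : spectrum s rho F -> spectrum s rho G ->
  spectrum s rho (fun x => F x + G x).
Proof.
move=> sF sG k t st bk rk.
rewrite -[RHS]addr0 -{1}(sF k t st bk rk) -(sG k t st bk rk) -grid_meanD.
by apply: eq_grid_mean => x; rewrite mulrDl.
Qed.

Lemma spectrumZ s rho c F : spectrum s rho F -> spectrum s rho (fun x => c * F x).
Proof.
move=> sF k t st bk rk; rewrite -[RHS](mulr0 c) -(sF k t st bk rk) -grid_meanZ.
by apply: eq_grid_mean => x; rewrite mulrA.
Qed.

Lemma spectrum_sum (I : Type) (r : seq I) s rho (F : I -> 'cV[R]_d -> R[i]) :
  (forall i, spectrum s rho (F i)) -> spectrum s rho (fun x => \sum_(i <- r) F i x).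
Proof.
move=> sF k t st bk rk.
transitivity (E (fun x => \sum_(i <- r) F i x * chr k x)).
  by apply: eq_grid_mean => x; rewrite mulr_suml.
by rewrite grid_mean_sum big1 // => i _; exact: (sF i k t).
Qed.

Lemma spectrum1 : spectrum 0 0 (fun=> 1).
Proof.
move=> k t st bk rk.
rewrite (eq_grid_mean _ (G := chr k)) => [|x]; last by rewrite mul1r.
rewrite grid_mean_chr //; first by apply: contraTneq rk => ->; rewrite size0 ltxx.
move=> i; rewrite (le_lt_trans (bk i)) // ltz_nat (leq_ltn_trans _ THM) //.
by rewrite leq_mul2r -[t]add0n st orbT.
Qed.

(** Testing F times [chr l] against [chr k] is testing F against [chr (l + k)], and the size of l +
    k is at least size k - size l. *)
Lemma spectrum_chr s rho t l F : spectrum s rho F -> bounded_freq (t * H) l ->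
  spectrum (s + t) (rho + size l) (fun x => F x * chr l x).
Proof.
move=> sF bl k t' st bk rk.
rewrite (eq_grid_mean _ (G := fun x => F x * chr (l + k) x)) => [|x]; last first.
  by rewrite chrD mulrA.
apply: (sF _ (t + t')%N); first by rewrite addnA.
  by rewrite mulnDl; exact: bounded_freqD.
have : size k <= size (l + k) + size l.
  by rewrite -[size l]sizeN (le_trans _ (sizeD _ _)) // addrC addKr.
by move: rk; lra.
Qed.

Variables (eta : nat -> 'cV[int]_d) (om : nat -> R[i]) (Lam : R).
Hypothesis om1 : forall n, normc (om n) = 1.
Hypothesis eta_bounded : forall n, (n < Nmax)%N -> bounded_freq H (eta n).
Hypothesis size_eta : forall n, size (eta n) = Lam ^+ n.
Hypothesis Lam1 : 1 < Lam.

Definition orbit_chr n x := om n * chr (eta n) x.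
Local Notation X := orbit_chr.

Lemma normc_orbit n x : normc (X n x) = 1.
Proof. by rewrite ComplexField.Normc.normcM om1 normc_chr mulr1. Qed.

Lemma orbitJ n x : (conjc (X n x)) = (conjc (om n)) * chr (- eta n) x.
Proof. by rewrite rmorphM chrN. Qed.

Lemma orbit_mulJ n x : X n x * (conjc (X n x)) = 1.
Proof. by rewrite normc_sqr normc_orbit expr1n. Qed.

Lemma spectrum_orbit s rho n F : (n < Nmax)%N -> spectrum s rho F ->
  spectrum s.+1 (rho + Lam ^+ n) (fun x => F x * X n x).
Proof.
move=> nN sF; rewrite -size_eta -addn1.
apply: (@spectrum_ext _ _ (fun x => om n * (F x * chr (eta n) x))).
  by move=> x; rewrite mulrCA.
by apply/spectrumZ/spectrum_chr => //; rewrite mul1n; exact: eta_bounded.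
Qed.

Lemma spectrum_orbitJ s rho n F : (n < Nmax)%N -> spectrum s rho F ->
  spectrum s.+1 (rho + Lam ^+ n) (fun x => F x * (conjc (X n x))).
Proof.
move=> nN sF; rewrite -size_eta -sizeN -addn1.
apply: (@spectrum_ext _ _ (fun x => (conjc (om n)) * (F x * chr (- eta n) x))).
  by move=> x; rewrite orbitJ mulrCA.
apply/spectrumZ/spectrum_chr => //; rewrite mul1n.
by apply: bounded_freqN; exact: eta_bounded.
Qed.

(** X_n is a unimodular multiple of a character of size [Lam ^+ n], which lies beyond the spectrum
    of F; it costs one unit of the budget. *)
Lemma mean_orbit0 s rho n F : (n < Nmax)%N -> (s < T)%N -> spectrum s rho F ->
  rho < Lam ^+ n -> E (fun x => F x * X n x) = 0.
Proof.
move=> nN sT sF rn.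
rewrite (eq_grid_mean _ (G := fun x => om n * (F x * chr (eta n) x))) => [|x].
  rewrite grid_meanZ (sF _ 1%N) ?mulr0 ?addn1 ?size_eta //.
  by rewrite mul1n; exact: eta_bounded.
by rewrite mulrCA.
Qed.

Lemma mean_orbitJ0 s rho n F : (n < Nmax)%N -> (s < T)%N -> spectrum s rho F ->
  rho < Lam ^+ n -> E (fun x => F x * (conjc (X n x))) = 0.
Proof.
move=> nN sT sF rn.
rewrite (eq_grid_mean _ (G := fun x => (conjc (om n)) * (F x * chr (- eta n) x))) => [|x].
  rewrite grid_meanZ (sF _ 1%N) ?mulr0 ?addn1 ?sizeN ?size_eta //.
  by rewrite mul1n; apply: bounded_freqN; exact: eta_bounded.
by rewrite orbitJ mulrCA.
Qed.

Variables (r q : nat) (a : R) (theta : nat -> R[i]).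
Hypothesis q0 : (0 < q)%N.
Hypothesis a01 : 0 <= a <= 1.
Hypothesis theta1 : forall j, normc (theta j) <= 1.

Local Notation node j := (r + q * j)%N.

(** The lower index k0 allows the first factors, which have low frequency, to be split off and
    bounded pointwise. *)
Definition riesz (k0 k : nat) (x : 'cV[R]_d) : R :=
  \prod_(k0 <= j < k) (1 + a * complex.Re (theta j * X (node j) x)).

Lemma riesz_factor_bound j x :
  0 <= 1 + a * complex.Re (theta j * X (node j) x) <= 1 + a.
Proof.
have h : normc (theta j * X (node j) x) <= 1.
  by rewrite ComplexField.Normc.normcM normc_orbit mulr1.
have h1 := le_trans (Re_le_normc _) h.
have h2 := le_trans (ReN_le_normc _) h.
have /andP[a0 a1] := a01.
set z := complex.Re _ in h1 h2 *.
have : a * z <= a * 1 by rewrite ler_wpM2l.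
have : a * - z <= a * 1 by rewrite ler_wpM2l.
by rewrite mulrN mulr1 => ? ?; apply/andP; split; lra.
Qed.

Lemma riesz_ge0 k0 k x : 0 <= riesz k0 k x.
Proof. by apply: prodr_ge0 => j _; case/andP: (riesz_factor_bound j x). Qed.

Lemma riesz_le k0 k x : riesz k0 k x <= (1 + a) ^+ (k - k0).
Proof.
rewrite -prodr_const_nat; apply: ler_prod => j _; exact: riesz_factor_bound.
Qed.

Lemma riesz_cat k0 k1 k x : (k0 <= k1 <= k)%N ->
  riesz k0 k x = riesz k0 k1 x * riesz k1 k x.
Proof. by case/andP => h1 h2; rewrite /riesz (big_cat_nat h1 h2). Qed.

(** Writing Re z = (z + conj z) / 2, a new factor adds two copies of the product, with frequencies
    shifted by the node frequency and by its opposite. *)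
Lemma rieszS k0 k x : (k0 <= k)%N -> (riesz k0 k.+1 x)%:C =
  (riesz k0 k x)%:C
  + (a / 2)%:C * (theta k * ((riesz k0 k x)%:C * X (node k) x)
                  + (conjc (theta k)) * ((riesz k0 k x)%:C * (conjc (X (node k) x)))).
Proof.
move=> k0k; rewrite /riesz big_nat_recr //= rmorphM /=.
set P := (\prod_(_ <= j < _) _)%:C; set Y := X _ x.
have -> : (1 + a * complex.Re (theta k * Y))%:C
    = 1 + (a / 2)%:C * (theta k * Y + (conjc (theta k)) * (conjc Y)).
  rewrite -rmorphM /= addcJ; set z := complex.Re _.
  have -> : 2%:R = (2 : R)%:C by rewrite rmorph_nat.
  rewrite -!rmorphM -[1 in RHS](rmorph1 (real_complex R)) -rmorphD /=.
  by congr (_%:C); field.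
by ring.
Qed.

(** By [rieszS], each factor uses one unit of the budget and widens the spectrum by the size of its
    node. *)
Lemma spectrum_riesz s rho F k0 k : (k0 <= k)%N ->
  (forall j, (j < k)%N -> (node j < Nmax)%N) -> spectrum s rho F ->
  spectrum (s + (k - k0)) (rho + \sum_(k0 <= j < k) Lam ^+ node j)
    (fun x => F x * (riesz k0 k x)%:C).
Proof.
move=> k0k jN sF; elim: k k0k jN => [|k IH].
  rewrite leqn0 => /eqP -> _; rewrite big_geq // subnn addn0 addr0.
  by apply: spectrum_ext sF => x; rewrite /riesz big_geq // mulr1.
rewrite leq_eqVlt => /orP[/eqP <- _|].
  rewrite big_geq // subnn addn0 addr0.
  by apply: spectrum_ext sF => x; rewrite /riesz big_geq // mulr1.
rewrite ltnS => k0k jN.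
have {}IH := IH k0k (fun j jk => jN j (ltnW jk)).
have L0 : 0 <= Lam ^+ node k by rewrite exprn_ge0 // ltW // (lt_trans ltr01).
rewrite big_nat_recr //= subSn // addnS addrA.
have kN := jN k (ltnSn k).
have IX := spectrum_orbit kN IH.
have IJ := spectrum_orbitJ kN IH.
set c := rho + _ in IH IX IJ *.
have {}IH : spectrum (s + (k - k0)).+1 (c + Lam ^+ node k) _ :=
  spectrumW (leqnSn _) (eq_ind_r is_true L0 (lerDl c _)) IH.
apply: (spectrum_ext _ (spectrumD IH (spectrumZ (a / 2)%:C
  (spectrumD (spectrumZ (theta k) IX) (spectrumZ (conjc (theta k)) IJ))))).
by move=> x /=; rewrite rieszS //; ring.
Qed.

Lemma mean_rieszS F k0 k : (k0 <= k)%N -> E (fun x => F x * (riesz k0 k.+1 x)%:C)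
  = E (fun x => F x * (riesz k0 k x)%:C)
  + (a / 2)%:C * (theta k * E (fun x => (F x * (riesz k0 k x)%:C) * X (node k) x)
      + (conjc (theta k)) * E (fun x => (F x * (riesz k0 k x)%:C) * (conjc (X (node k) x)))).
Proof.
move=> k0k; rewrite -!grid_meanZ -grid_meanD -grid_meanZ -grid_meanD.
by apply: eq_grid_mean => x; rewrite rieszS //; ring.
Qed.

(** Both terms that a further factor adds have mean 0, because the size of its node exceeds all
    sizes in the spectrum of F times the preceding factors. *)
Lemma mean_riesz_stable s rho F k0 k k' : (k0 <= k <= k')%N -> (s + (k' - k0) <= T)%N ->
  (forall j, (j < k')%N -> (node j < Nmax)%N) -> spectrum s rho F ->
  (forall j, (k <= j < k')%N ->
     rho + \sum_(k0 <= i < j) Lam ^+ node i < Lam ^+ node j) ->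
  E (fun x => F x * (riesz k0 k' x)%:C) = E (fun x => F x * (riesz k0 k x)%:C).
Proof.
case/andP => k0k; elim: k' => [|k' IH].
  by rewrite leqn0 => /eqP ->.
rewrite leq_eqVlt => /orP[/eqP <- //|]; rewrite ltnS => kk' sT jN sF hj.
have k0k' := leq_trans k0k kk'.
have sT' : (s + (k' - k0) < T)%N by move: sT; rewrite subSn // addnS.
rewrite mean_rieszS //.
have sP := spectrum_riesz k0k' (fun j jk => jN j (ltnW jk)) sF.
have hk : rho + \sum_(k0 <= i < k') Lam ^+ node i < Lam ^+ node k'.
  by apply: hj; rewrite kk' /=.
rewrite (mean_orbit0 _ sT' sP hk) ?jN // (mean_orbitJ0 _ sT' sP hk) ?jN //.
rewrite !mulr0 addr0 mulr0 addr0; apply: IH => //.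
- by move: sT'; exact: ltnW.
- by move=> j jk; apply: jN; exact: ltnW.
- by move=> j /andP[h1 h2]; apply: hj; rewrite h1 ltnW.
Qed.

(** Consecutive nodes have sizes in ratio [tau]. In the hypothesis below, [Lam^-1] accounts for an
    X_n strictly between two nodes, and the multiple of [tau] leaves room for the earlier nodes and
    for a test function F. *)
Local Notation tau := (Lam ^- q).
Hypothesis tau_small : Lam^-1 + 5 * tau < 1.

Lemma tau_bounds : [/\ 0 < tau, 0 < Lam^-1, Lam^-1 < 1 & 5 * tau < 1].
Proof.
have L0 : 0 < Lam by rewrite (lt_trans ltr01).
have t0 : 0 < tau by rewrite invr_gt0 exprn_gt0.
have i0 : 0 < Lam^-1 by rewrite invr_gt0.
by move: tau_small => h; split => //; lra.
Qed.

Lemma nodeS_tau k : Lam ^+ node k = tau * Lam ^+ node k.+1.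
Proof.
rewrite mulnS addnCA [in RHS]exprD mulKf // expf_neq0 // gt_eqF //.
by rewrite (lt_trans ltr01).
Qed.

Lemma Lam_gt0 n : 0 < Lam ^+ n.
Proof. by rewrite exprn_gt0 // (lt_trans ltr01). Qed.

(** A geometric sum of ratio [tau] < 1/5; the induction closes because tau (1 + 2 tau) <= 2 tau. *)
Lemma sum_nodes_le k0 k : \sum_(k0 <= j < k) Lam ^+ node j <= 2 * tau * Lam ^+ node k.
Proof.
have [t0 _ _ t5] := tau_bounds.
elim: k => [|k IH].
  by rewrite big_geq // mulr_ge0 ?mulr_ge0 // ltW // Lam_gt0.
have [k0k|kk0] := leqP k0 k; last first.
  by rewrite big_geq // mulr_ge0 ?mulr_ge0 // ltW // Lam_gt0.
rewrite big_nat_recr //= (le_trans (lerD IH (lexx _))) // (nodeS_tau k).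
set U := Lam ^+ (_ + _); have U0 : 0 < U := Lam_gt0 _.
have tU : 0 < tau * U by rewrite mulr_gt0.
have : tau * (tau * U) <= 5^-1 * (tau * U) by rewrite ler_wpM2r // ?ltW //; lra.
lra.
Qed.

Lemma Lam_node_mono k j : (k <= j)%N -> Lam ^+ node k <= Lam ^+ node j.
Proof.
by move=> kj; rewrite ler_weXn2l // ?(ltW Lam1) // leq_add2l leq_mul2l kj orbT.
Qed.

Lemma Lam_ltn n m : (n < m)%N -> Lam ^+ n <= Lam^-1 * Lam ^+ m.
Proof.
move=> nm; rewrite -[Lam ^+ n](mulKf (x := Lam)); last first.
  by rewrite gt_eqF // (lt_trans ltr01).
rewrite -exprS; apply: ler_wpM2l; first by rewrite invr_ge0 ltW // (lt_trans ltr01).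
by rewrite ler_weXn2l // ltW.
Qed.

(** The integral of X_n against the Riesz product; the test recognises a node n = r + q j and the
    quotient recovers j. *)
Definition riesz_mean (n : nat) : R[i] :=
  if (r <= n)%N && (q %| n - r)%N then (a / 2)%:C * (conjc (theta ((n - r) %/ q))) else 0.

(** Only a conj X_n coming from the factor at n can cancel X_n; every other term keeps a nonzero
    dominant frequency. The test function F is later 1, which gives means, or conj X_m with m + q <=
    n, which gives decorrelation. *)
Lemma mean_orbit_riesz s rho F K n : (n < K)%N -> (s + K + 3 <= T)%N ->
  (forall j, (j <= K)%N -> (node j < Nmax)%N) -> spectrum s rho F ->
  rho <= tau * Lam ^+ n ->
  E (fun x => F x * X n x * (riesz 0 K x)%:C)
  = riesz_mean n * E (fun x => F x * (riesz 0 K x)%:C).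
Proof.
move=> nK sT jN sF rn.
have [t0 v0 v1 t5] := tau_bounds.
have Ln := Lam_gt0 n.
have nodeK j : (j <= node j)%N.
  by rewrite (leq_trans (leq_pmull j q0)) // leq_addl.
have nN : (n < Nmax)%N by rewrite (leq_trans nK) // (leq_trans (nodeK K)) // ltnW // jN.
have jN' k : (k <= K)%N -> forall j, (j < k)%N -> (node j < Nmax)%N.
  by move=> kK j jk; apply: jN; rewrite (leq_trans (ltnW jk)).
have sX : spectrum s.+1 (rho + Lam ^+ n) (fun x => F x * X n x).
  exact: spectrum_orbit.
have tauLn : tau * Lam ^+ n <= 5^-1 * Lam ^+ n.
  by rewrite ler_wpM2r // ?ltW //; lra.
rewrite /riesz_mean; case: ifPn => [/andP[rn' /dvdnP[k hk]]|].
- have nE : n = node k by rewrite [(q * k)%N]mulnC -hk subnKC.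
  rewrite hk mulnK // {hk}.
  have kn : (k <= n)%N by rewrite nE.
  have kK : (k < K)%N := leq_ltn_trans kn nK.
  have kK' := ltnW kK.
  have bigj j : (k < j)%N -> Lam ^+ n <= tau * Lam ^+ node j.
    move=> kj; rewrite nE nodeS_tau; apply: ler_wpM2l; first exact: ltW.
    exact: (Lam_node_mono kj).
  (* The factors after the one at n drop out; that one is then expanded by [mean_rieszS] into the
     three terms treated below. *)
  rewrite (@mean_riesz_stable s.+1 (rho + Lam ^+ n) _ 0 k.+1 K) //; first last.
  + move=> j /andP[kj _].
    have h1 := bigj _ kj; have h2 := sum_nodes_le 0 j.
    have U0 := Lam_gt0 (node j).
    set U := Lam ^+ node j in h1 h2 U0 *.
    have h3 : 5 * tau * U < 1 * U by rewrite ltr_pM2r.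
    by lra.
  + exact: jN'.
  + by clear -sT kK; lia.
  rewrite mean_rieszS //.
  (* The constant 1 of the factor leaves X_n alone above the earlier nodes. *)
  have -> : E (fun x => F x * X n x * (riesz 0 k x)%:C) = 0.
    rewrite (eq_grid_mean _ (G := fun x => F x * (riesz 0 k x)%:C * X n x)); last first.
      by move=> x; rewrite mulrAC.
    apply: (mean_orbit0 nN _ (spectrum_riesz (leq0n k) (jN' _ kK') sF)).
      by clear -sT kK; lia.
    have := sum_nodes_le 0 k; rewrite -nE; lra.
  rewrite -nE.
  (* The term with X_n doubles the frequency, to size 2 Lam^n. *)
  have -> : E (fun x => F x * X n x * (riesz 0 k x)%:C * X n x) = 0.
    pose G x := om n * om n * (F x * (riesz 0 k x)%:C * chr (eta n + eta n) x).
    rewrite (eq_grid_mean _ (G := G)) => [|x]; last first.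
      by rewrite /G /orbit_chr chrD; ring.
    rewrite grid_meanZ.
    rewrite (spectrum_riesz (leq0n k) (jN' _ kK') sF (t := 2)) ?mulr0 //.
    + by clear -sT kK; lia.
    + rewrite mulSn mul1n.
      by apply: bounded_freqD; exact: eta_bounded.
    + rewrite size_double size_eta.
      by have := sum_nodes_le 0 k; rewrite -nE; lra.
  (* The term with conj X_n is the only one to survive. *)
  have -> : E (fun x => F x * X n x * (riesz 0 k x)%:C * (conjc (X n x)))
      = E (fun x => F x * (riesz 0 k x)%:C).
    apply: eq_grid_mean => x.
    by rewrite -[RHS]mulr1 -(orbit_mulJ n x); ring.
  (* All factors from the k-th on are restored, now against F alone. *)
  rewrite mulr0 !add0r mulrA; congr (_ * _); apply/esym.
  apply: (@mean_riesz_stable s rho) => //.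
  + by clear -sT kK; lia.
  + exact: jN'.
  + move=> j /andP[kj _].
    have h1 := Lam_node_mono kj; rewrite -nE in h1; have h2 := sum_nodes_le 0 j.
    have U0 := Lam_gt0 (node j).
    set U := Lam ^+ node j in h1 h2 U0 *.
    have h3 : 5 * tau * U < 1 * U by rewrite ltr_pM2r.
    by lra.
- move=> hn; rewrite mul0r.
  (* Here n is not a node and k counts the nodes below n: the factors from the k-th on drop out, and
     X_n dominates the others. *)
  have [k [kK nk hsum]] : exists k, [/\ (k <= K)%N, (n < node k)%N &
      \sum_(0 <= i < k) Lam ^+ node i <= Lam^-1 * (1 + 2 * tau) * Lam ^+ n].
    have [nr|rn'] := ltnP n r.
      exists 0%N; split => //; first by rewrite muln0 addn0.
      by rewrite big_geq // !mulr_ge0 // ltW //; lra.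
    have qn : ~~ (q %| n - r)%N by move: hn; rewrite rn'.
    exists ((n - r) %/ q).+1.
    have hd := divn_eq (n - r) q.
    have hm := ltn_pmod (n - r) q0.
    have hm0 : (0 < (n - r) %% q)%N by rewrite lt0n.
    set k := ((n - r) %/ q)%N in hd *.
    have kn : (node k < n)%N by clear -hd hm0 rn'; lia.
    split.
    + by rewrite (leq_trans _ nK) // ltnS (leq_trans (nodeK k)) // ltnW.
    + by rewrite mulnS; clear -hd hm rn'; lia.
    + rewrite big_nat_recr //=.
      have h1 := sum_nodes_le 0 k.
      have h2 := Lam_ltn kn.
      have h3 : (1 + 2 * tau) * Lam ^+ node k <= (1 + 2 * tau) * (Lam^-1 * Lam ^+ n).
        by rewrite ler_wpM2l //; lra.
      by lra.
  have tvL : tau * (Lam^-1 * Lam ^+ n) <= tau * (1 * Lam ^+ n).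
    by apply: ler_wpM2l; [exact: ltW | rewrite ler_pM2r // ltW].
  have tvL' : (Lam^-1 + 5 * tau) * Lam ^+ n < 1 * Lam ^+ n by rewrite ltr_pM2r.
  have tL := mulr_gt0 t0 Ln.
  rewrite (@mean_riesz_stable s.+1 (rho + Lam ^+ n) _ 0 k K) //; first last.
  + move=> j /andP[kj _].
    have h1 : Lam ^+ n <= Lam^-1 * Lam ^+ node j.
      rewrite (le_trans (Lam_ltn nk)) //.
      by apply: ler_wpM2l; [exact: ltW | exact: (Lam_node_mono kj)].
    have h2 := sum_nodes_le 0 j.
    have U0 := Lam_gt0 (node j).
    set U := Lam ^+ node j in h1 h2 U0 *.
    have h3 : (Lam^-1 + 5 * tau) * U < 1 * U by rewrite ltr_pM2r.
    have h4 : Lam^-1 * U <= 1 * U by rewrite ler_pM2r // ltW.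
    have h5 : tau * Lam ^+ n <= tau * U.
      by apply: ler_wpM2l; [exact: ltW | rewrite (le_trans h1) // (le_trans h4) // mul1r].
    have h6 := mulr_gt0 t0 U0.
    by lra.
  + exact: jN'.
  + by clear -sT kK; lia.
  rewrite (eq_grid_mean _ (G := fun x => F x * (riesz 0 k x)%:C * X n x)); last first.
    by move=> x; rewrite mulrAC.
  apply: (mean_orbit0 nN _ (spectrum_riesz (leq0n k) (jN' _ kK) sF)).
    by clear -sT kK; lia.
  by lra.
Qed.

(** When the spectrum of F stays below half the first node, F and the earlier nodes of the tail
    never reach a new node: 1/2 + 2 tau < 1. *)
Lemma mean_riesz_tail s rho F k0 K : (s + (K - k0) <= T)%N ->
  (forall j, (j < K)%N -> (node j < Nmax)%N) -> spectrum s rho F ->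
  2 * rho <= Lam ^+ node k0 ->
  E (fun x => F x * (riesz k0 K x)%:C) = E F.
Proof.
move=> sT jN sF rk.
have [t0 _ _ t5] := tau_bounds.
have [Kk|kK] := leqP K k0.
  by apply: eq_grid_mean => x; rewrite /riesz big_geq // mulr1.
rewrite (@mean_riesz_stable s rho F k0 k0 K) ?leqnn ?(ltnW kK) //.
  by apply: eq_grid_mean => x; rewrite /riesz big_geq // mulr1.
move=> j /andP[kj _].
have h1 := Lam_node_mono kj; have h2 := sum_nodes_le k0 j.
have U0 := Lam_gt0 (node j).
set U := Lam ^+ (r + q * j) in h1 h2 U0 *.
have h3 : 5 * tau * U < 1 * U by rewrite ltr_pM2r.
by lra.
Qed.

Lemma mean_riesz k0 K : (K - k0 <= T)%N ->
  (forall j, (j < K)%N -> (node j < Nmax)%N) -> E (riesz k0 K) = 1.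
Proof.
move=> KT jN; apply: (@complexI R); rewrite -grid_mean_real.
rewrite (eq_grid_mean _ (G := fun x => (fun=> 1) x * (riesz k0 K x)%:C)); last first.
  by move=> x; rewrite mul1r.
rewrite (mean_riesz_tail _ jN spectrum1) ?grid_mean1 //.
by rewrite mulr0 ltW // Lam_gt0.
Qed.

(** * Fejer kernels and the mass they receive *)

Section Fejer.
Variable L : nat.
Hypotheses (L0 : (0 < L)%N) (LH : (L <= H)%N) (T1 : (1 <= T)%N).

Definition lattice_freq (l : {ffun 'I_d -> 'I_L}) : 'cV[int]_d := \col_i (l i)%:Z.

Lemma lattice_freqB l l' : bounded_freq L (lattice_freq l - lattice_freq l').
Proof.
move=> i; rewrite !mxE.
by move: (ltn_ord (l i)) (ltn_ord (l' i)); clear; lia.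
Qed.

Lemma lattice_freqB_eq0 l l' : (lattice_freq l - lattice_freq l' == 0) = (l == l').
Proof.
rewrite subr_eq0; apply/eqP/eqP => [/colP h|-> //].
by apply/ffunP => i; apply/val_inj; have := h i; rewrite !mxE; case.
Qed.

(** Dirichlet kernel of the box [0, L)^d centred at c and divided by L^d, so that its squared
    modulus [fejer] is 1 at c and has mean L^-d. *)
Definition fejer_root (c x : 'cV[R]_d) : R[i] :=
  (L%:R ^+ d)^-1 * \sum_(l : {ffun 'I_d -> 'I_L}) chr (lattice_freq l) (x - c).

Definition fejer (c x : 'cV[R]_d) : R := normc (fejer_root c x) ^+ 2.

Lemma fejerE c x : (fejer c x)%:C = (L%:R ^+ d)^-1 * (L%:R ^+ d)^-1 *
  \sum_(l : {ffun 'I_d -> 'I_L}) \sum_(l' : {ffun 'I_d -> 'I_L})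
    chr (lattice_freq l - lattice_freq l') (- c) *
    (1 * chr (lattice_freq l - lattice_freq l') x).
Proof.
rewrite /fejer -normc_sqr /fejer_root.
set p := _^-1; have pJ : conjc p = p.
  by rewrite fmorphV rmorphXn /= conjc_nat.
rewrite conjcM pJ mulrACA conjc_sum; congr (_ * _).
rewrite mulr_suml; apply: eq_bigr => l _.
rewrite mulr_sumr; apply: eq_bigr => l' _.
rewrite -chrN -chrD mul1r [RHS]mulrC /chr -e1D -pairingDr.
by [].
Qed.

Lemma spectrum_fejer c rho : (forall k, bounded_freq L k -> size k <= rho) ->
  spectrum 1 rho (fun x => (fejer c x)%:C).
Proof.
move=> hrho; apply: (spectrum_ext (fsym (fejerE c))).
apply/spectrumZ/spectrum_sum => l; apply/spectrum_sum => l'; apply/spectrumZ.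
have bl : bounded_freq (1 * H) (lattice_freq l - lattice_freq l').
  by rewrite mul1n; apply: bounded_freqW LH _; exact: lattice_freqB.
apply: (spectrumW _ _ (spectrum_chr spectrum1 bl)); first by rewrite add0n.
by rewrite add0r; apply: hrho; exact: lattice_freqB.
Qed.

Lemma mean_fejer c : E (fejer c) = (L%:R ^+ d)^-1.
Proof.
apply: (@complexI R); rewrite -grid_mean_real (eq_grid_mean _ (fejerE c)).
rewrite grid_meanZ grid_mean_sum.
under eq_bigr => l _ do rewrite grid_mean_sum.
have HM : (H < M)%N by rewrite (leq_ltn_trans _ THM) // leq_pmull.
have h l l' : E (fun x => chr (lattice_freq l - lattice_freq l') (- c) *
    (1 * chr (lattice_freq l - lattice_freq l') x)) = (l == l')%:R :> R[i].
  rewrite grid_meanZ; case: (altP (l =P l')) => [->|ll'].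
    rewrite subrr chr0 mul1r (eq_grid_mean _ (G := fun=> 1)) => [|x]; first exact: grid_mean1.
    by rewrite chr0 mulr1.
  rewrite (eq_grid_mean _ (G := chr (lattice_freq l - lattice_freq l'))); last first.
    by move=> x; rewrite mul1r.
  rewrite grid_mean_chr ?mulr0 ?lattice_freqB_eq0 // => i.
  rewrite (le_lt_trans (lattice_freqB l l' i)) // ltz_nat.
  exact: leq_ltn_trans LH HM.
under eq_bigr => l _ do under eq_bigr => l' _ do rewrite h.
have -> : \sum_(l : {ffun 'I_d -> 'I_L}) \sum_(l' : {ffun 'I_d -> 'I_L}) (l == l')%:R
    = L%:R ^+ d :> R[i].
  transitivity (\sum_(l : {ffun 'I_d -> 'I_L}) (1 : R[i])).
    apply: eq_bigr => l _; rewrite (bigD1 l) //= eqxx big1 ?addr0 // => l' /negbTE.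
    by rewrite eq_sym => ->.
  by rewrite sumr_const card_ffun !card_ord natrX.
rewrite mulfVK ?expf_neq0 ?pnatr_eq0 ?gtn_eqF //.
by rewrite fmorphV rmorphXn rmorph_nat.
Qed.

(** The first k factors are at most 1 + a each; the remaining ones start above twice the frequencies
    of the kernel and do not change its mean. *)
Lemma fejer_riesz_mass c rho k K : (K < T)%N ->
  (forall j, (j < K)%N -> (node j < Nmax)%N) ->
  (forall k, bounded_freq L k -> size k <= rho) -> 2 * rho <= Lam ^+ node k ->
  E (fun x => fejer c x * riesz 0 K x) <= (1 + a) ^+ k * (L%:R ^+ d)^-1.
Proof.
move=> KT jN hrho hk.
have a1 : 1 <= 1 + a by case/andP: a01 => ? _; rewrite lerDl.
have f0 x : 0 <= fejer c x by exact: sqr_ge0.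
rewrite -(mean_fejer c).
have [Kk|kK] := leqP K k.
  rewrite -grid_meanZ; apply: ler_grid_mean => x.
  rewrite mulrC ler_wpM2r // (le_trans (riesz_le 0 K x)) //.
  by rewrite subn0 ler_weXn2l.
have -> : E (fejer c) = E (fun x => fejer c x * riesz k K x).
  apply: (@complexI R); rewrite -!grid_mean_real.
  have KT' : (1 + (K - k) <= T)%N by clear -KT; lia.
  rewrite -(mean_riesz_tail KT' jN (spectrum_fejer c hrho) hk).
  by apply: eq_grid_mean => x; rewrite [RHS]rmorphM.
rewrite -grid_meanZ; apply: ler_grid_mean => x.
rewrite (riesz_cat (k1 := k)) ?(ltnW kK) // mulrCA.
apply: ler_wpM2r; first by rewrite mulr_ge0 ?riesz_ge0.
by rewrite (le_trans (riesz_le 0 k x)) // subn0.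
Qed.

Lemma fejer_pi c x y : \pi_(torus R d) x = \pi_(torus R d) y -> fejer c x = fejer c y.
Proof.
move=> xy; rewrite /fejer /fejer_root; congr (normc (_ * _) ^+ 2); apply: eq_bigr => l _.
by rewrite /chr !pairingDr !e1D -!/(chr _ _) (chr_pi _ xy).
Qed.

(** Entries of l are below L, so <l, x - c> has modulus at most d L / (8 d L) = 1/8 and every
    character in the sum has real part at least 1/2. *)
Lemma fejer_ge (c x : 'cV[R]_d) : (forall i, `|x i 0 - c i 0| <= (8 * d%:R * L%:R)^-1) ->
  4^-1 <= fejer c x.
Proof.
move=> xc.
have hl l : 2^-1 <= complex.Re (chr (lattice_freq l) (x - c)).
  apply: Re_e1_ge; rewrite (le_trans (ler_norm_sum _ _ _)) //.
  apply: (@le_trans _ _ (\sum_(i < d) (8 * d%:R)^-1)).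
    apply: ler_sum => i _; rewrite !mxE normrM.
    have d0 : (0 < d)%N by rewrite (leq_trans _ (ltn_ord i)).
    apply: (@le_trans _ _ (L%:R * (8 * d%:R * L%:R)^-1)).
      apply: ler_pM => //.
      by rewrite -pmulrn normr_nat ler_nat ltnW.
    by rewrite invfM mulrCA mulfV ?mulr1 // pnatr_eq0 -lt0n.
  rewrite sumr_const card_ord -[X in X <= _]mulr_natr invfM -mulrA.
  case: (posnP d) => [->|d0]; first by rewrite mulr0 mulr0 invr_ge0.
  by rewrite mulVf ?mulr1 // pnatr_eq0 -lt0n.
have p0 : 0 < (L%:R ^+ d)^-1 :> R by rewrite invr_gt0 exprn_gt0 // ltr0n.
have h : 2^-1 <= normc (fejer_root c x).
  apply: le_trans (Re_le_normc _); rewrite /fejer_root.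
  have -> : (L%:R ^+ d)^-1 = ((L%:R ^+ d)^-1 : R)%:C :> R[i].
    by rewrite fmorphV rmorphXn rmorph_nat.
  set S := \sum_l _.
  have -> : complex.Re (((L%:R ^+ d)^-1 : R)%:C * S)
      = (L%:R ^+ d)^-1 * complex.Re S.
    by case: S => u v /=; rewrite mul0r subr0.
  rewrite ler_pdivlMl ?exprn_gt0 ?ltr0n // /S.
  rewrite Re_sum.
  apply: (@le_trans _ _ (\sum_(l : {ffun 'I_d -> 'I_L}) 2^-1)); last first.
    by apply: ler_sum.
  by rewrite sumr_const card_ffun !card_ord -[leRHS]mulr_natl natrX.
have -> : 4^-1 = 2^-1 ^+ 2 :> R by field.
by rewrite /fejer lerXn2r ?nnegrE ?normc_ge0 // invr_ge0.
Qed.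

End Fejer.

(** * Variance of the weighted orbit sums under the Riesz product *)

Section SecondMoment.
Variables (w : nat -> R[i]) (W : R) (K N : nat).
Hypothesis wW : forall n, normc (w n) <= W.
Hypothesis NK : (N <= K)%N.
Hypothesis KT : (K + 4 <= T)%N.
Hypothesis jN : forall j, (j <= K)%N -> (node j < Nmax)%N.

Local Notation P := (riesz 0 K).
Local Notation Y n x := (X n x - riesz_mean n).

Lemma normc_riesz_mean n : normc (riesz_mean n) <= 1.
Proof.
rewrite /riesz_mean; case: ifP => _; last by rewrite ComplexField.Normc.normc0.
case/andP: a01 => a0 a1; rewrite ComplexField.Normc.normcM normc_real normc_conjc ger0_norm ?divr_ge0 //.
by rewrite -[leRHS]mulr1 ler_pM ?divr_ge0 ?normc_ge0 //; lra.
Qed.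

Lemma riesz_total : E (fun x => (P x)%:C) = 1.
Proof.
rewrite grid_mean_real mean_riesz ?rmorph1 ?subn0 //; first by clear -KT; lia.
by move=> j jK; rewrite jN // ltnW.
Qed.

Lemma mean_orbit1 n : (n < N)%N -> E (fun x => X n x * (P x)%:C) = riesz_mean n.
Proof.
move=> nN; have nK := leq_trans nN NK.
rewrite -[RHS]mulr1 -riesz_total.
have := @mean_orbit_riesz 0 0 (fun=> 1) K n nK _ jN spectrum1 _.
have [t0 _ _ _] := tau_bounds.
rewrite mulr_ge0 ?ltW ?Lam_gt0 // => /(_ _ isT) h.
transitivity (E (fun x => 1 * X n x * (P x)%:C)).
  by apply: eq_grid_mean => x; rewrite mul1r.
rewrite h; last by clear -KT; lia.
by congr (_ * _); apply: eq_grid_mean => x; rewrite mul1r.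
Qed.

Lemma conjc_grid_mean (F : 'cV[R]_d -> R[i]) : conjc (E F) = E (fun x => conjc (F x)).
Proof.
by rewrite /grid_mean rmorphM fmorphV rmorphXn /= conjc_nat rmorph_sum.
Qed.

(** [mean_orbit_riesz] applies with F = conj X_m, whose size Lam^m is at most tau Lam^n exactly
    because m + q <= n. *)
Lemma cov_far0 n m : (n < N)%N -> (m + q <= n)%N ->
  E (fun x => Y n x * conjc (Y m x) * (P x)%:C) = 0.
Proof.
move=> nN mn.
have mN : (m < N)%N by rewrite (leq_trans _ nN) // ltnS (leq_trans _ mn) // leq_addr.
have mNx : (m < Nmax)%N.
  rewrite (leq_trans mN) // (leq_trans NK) // (leq_trans _ (ltnW (jN (leqnn K)))) //.
  by rewrite (leq_trans (leq_pmull K q0)) // leq_addl.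
have hm : 0 + Lam ^+ m <= tau * Lam ^+ n.
  rewrite add0r -(ler_pM2l (Lam_gt0 q)) mulrA mulfV ?mul1r ?gt_eqF ?Lam_gt0 //.
  by rewrite -exprD ler_weXn2l // ?ltW // addnC.
have nK := leq_trans nN NK.
have KT' : (1 + K + 3 <= T)%N by clear -KT; lia.
have := mean_orbit_riesz nK KT' jN (spectrum_orbitJ mNx spectrum1) hm.
set f1 := (fun x => _); set f2 := (fun x => _) => h.
rewrite (eq_grid_mean _ (G := fun x => f1 x + ((- riesz_mean n) * f2 x +
   (- conjc (riesz_mean m) * (X n x * (P x)%:C) +
   riesz_mean n * conjc (riesz_mean m) * (P x)%:C)))); last first.
  by move=> x; rewrite /f1 /f2 conjcB; ring.
rewrite !grid_meanD !grid_meanZ h riesz_total mean_orbit1 //; ring.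
Qed.

Lemma cov_le n m : (n < N)%N -> (m < N)%N ->
  normc (E (fun x => Y n x * conjc (Y m x) * (P x)%:C))
  <= 4 * ((n < m + q) && (m < n + q))%N%:R.
Proof.
move=> nN mN.
have [h1|mn] := ltnP n (m + q); last by rewrite cov_far0 // ComplexField.Normc.normc0 mulr0.
have [h2|nm] := ltnP m (n + q); last first.
  rewrite -normc_conjc conjc_grid_mean.
  rewrite (eq_grid_mean _ (G := fun x => Y m x * conjc (Y n x) * (P x)%:C)); last first.
    by move=> x; rewrite !conjcM conjcK conjc_real [Y m x * _]mulrC.
  by rewrite cov_far0 // ComplexField.Normc.normc0 mulr0.
have Y2 k x : normc (Y k x) <= 2.
  rewrite (le_trans (ler_normcD _ _)) // normc_opp normc_orbit.
  by have := normc_riesz_mean k; lra.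
rewrite (le_trans (normc_grid_mean _ _)) // mulr1.
have PE : E P = 1.
  by apply: (@complexI R); rewrite -grid_mean_real riesz_total.
apply: (@le_trans _ _ (E (fun x => 4 * P x))); last first.
  by rewrite grid_meanZ PE mulr1.
apply: ler_grid_mean => x.
rewrite !ComplexField.Normc.normcM normc_real ger0_norm ?riesz_ge0 // normc_conjc.
rewrite ler_wpM2r ?riesz_ge0 //.
have -> : 4 = 2 * 2 :> R by ring.
by rewrite ler_pM ?normc_ge0.
Qed.

Definition riesz_total_mean : R[i] := \sum_(0 <= n < N) w n * riesz_mean n.

Lemma near_diagonal_count n : (\sum_(0 <= m < N) ((n < m + q) && (m < n + q)) <= 2 * q)%N.
Proof.
have h A B : (\sum_(0 <= m < N) ((A <= m) && (m < B)) <= minn N B - A)%N.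
  elim: N => [|N' IH]; first by rewrite big_geq.
  rewrite big_nat_recr //= (leq_trans (leq_add IH (leqnn _))) //.
  by clear; case: (leqP A N'); case: (ltnP N' B); rewrite /=; lia.
apply: (@leq_trans (\sum_(0 <= m < N) ((n.+1 - q <= m) && (m < n + q)))).
  by apply: leq_sum => m _; clear; lia.
by apply: leq_trans (h _ _) _; clear; lia.
Qed.

(** Expanding the square gives covariances. For each n at most 2q indices m have |n - m| < q, each
    contributing at most 4 W^2; all other covariances vanish. *)
Lemma second_moment :
  E (fun x => normc (\sum_(0 <= n < N) w n * X n x - riesz_total_mean) ^+ 2 * P x)
  <= 8 * q%:R * W ^+ 2 * N%:R.
Proof.
have W0 : 0 <= W := le_trans (normc_ge0 _) (wW 0).
set Ex := E _.
have Ex0 : 0 <= Ex.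
  rewrite /Ex mulr_ge0 ?invr_ge0 ?exprn_ge0 //; apply: sumr_ge0 => g _.
  by rewrite mulr_ge0 ?sqr_ge0 ?riesz_ge0.
rewrite -(ger0_norm Ex0) -normc_real /Ex -grid_mean_real.
rewrite (eq_grid_mean _ (G := fun x => \sum_(0 <= n < N) \sum_(0 <= m < N)
   (w n * conjc (w m)) * (Y n x * conjc (Y m x) * (P x)%:C))); last first.
  move=> x; rewrite [LHS]real_complexM -normc_sqr /riesz_total_mean -sumrB.
  under eq_bigr => n _ do rewrite -mulrBr.
  rewrite conjc_sum !mulr_suml; apply: eq_bigr => n _.
  rewrite mulr_sumr mulr_suml; apply: eq_bigr => m _.
  by rewrite conjcM; ring.
rewrite grid_mean_sum (le_trans (normc_sum _ _ _)) //.
apply: (@le_trans _ _ (\sum_(0 <= n < N) (8 * q%:R * W ^+ 2))); last first.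
  by rewrite sumr_const_nat subn0 -[leLHS]mulr_natr.
rewrite big_nat [leRHS]big_nat; apply: ler_sum => n /andP[_ nN].
rewrite grid_mean_sum (le_trans (normc_sum _ _ _)) //.
apply: (@le_trans _ _ (\sum_(0 <= m < N) W ^+ 2 * (4 * ((n < m + q) && (m < n + q))%N%:R))).
  rewrite big_nat [leRHS]big_nat; apply: ler_sum => m /andP[_ mN].
  rewrite grid_meanZ ComplexField.Normc.normcM ler_pM ?normc_ge0 //; last exact: cov_le.
  by rewrite ComplexField.Normc.normcM normc_conjc expr2 ler_pM ?normc_ge0.
rewrite -mulr_sumr -mulr_sumr -natr_sum mulrC ler_wpM2r ?sqr_ge0 //.
have -> : 8 * q%:R = 4 * (2 * q)%:R :> R by rewrite natrM; ring.
by rewrite ler_wpM2l // ler_nat near_diagonal_count.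
Qed.

(** Where the sum is below delta N it deviates by at least delta N from its mean, of modulus at
    least 2 delta N. *)
Lemma riesz_chebyshev (delta : R) : 0 < delta -> (0 < N)%N ->
  2 * delta * N%:R <= normc riesz_total_mean ->
  E (fun x => (normc (\sum_(0 <= n < N) w n * X n x) < delta * N%:R)%R%:R * P x)
  <= 8 * q%:R * W ^+ 2 / (delta ^+ 2 * N%:R).
Proof.
move=> d0 N0 hmu.
have Nr : 0 < N%:R :> R by rewrite ltr0n.
have dN : 0 < delta * N%:R by rewrite mulr_gt0.
have -> : 8 * q%:R * W ^+ 2 / (delta ^+ 2 * N%:R)
    = ((delta * N%:R) ^+ 2)^-1 * (8 * q%:R * W ^+ 2 * N%:R).
  by field; rewrite !gt_eqF.
apply: le_trans (ler_wpM2l _ second_moment); last by rewrite invr_ge0 sqr_ge0.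
rewrite -grid_meanZ; apply: ler_grid_mean => x.
rewrite mulrA ler_wpM2r ?riesz_ge0 //.
case: ltP => [hS|_]; last by rewrite mulr_ge0 ?invr_ge0 ?sqr_ge0.
rewrite ler_pdivlMl ?exprn_gt0 // mulr1 lerXn2r ?nnegrE ?normc_ge0 ?ltW //.
rewrite -normc_opp opprB; have := ler_normcB riesz_total_mean (\sum_(0 <= n < N) w n * X n x).
lra.
Qed.

End SecondMoment.

End RieszProduct.

(** * The Riesz product as a positive functional *)

Section RieszFunctional.
Variables (R : realType) (d : nat).
Variable size : 'cV[int]_d -> R.
Hypothesis size0 : size 0 = 0.
Hypothesis sizeN : forall k, size (- k) = size k.
Hypothesis sizeD : forall k l, size (k + l) <= size k + size l.
Hypothesis size_double : forall k, size (k + k) = 2 * size k.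
Variable U : R.
Hypothesis size_bounded : forall S k, bounded_freq S k -> size k <= U * S%:R.

Variables (eta : nat -> 'cV[int]_d) (om : nat -> R[i]) (Lam : R).
Hypothesis om1 : forall n, normc (om n) = 1.
Hypothesis size_eta : forall n, size (eta n) = Lam ^+ n.
Hypothesis Lam1 : 1 < Lam.

Variables (r q : nat) (a : R) (theta : nat -> R[i]).
Hypothesis q0 : (0 < q)%N.
Hypothesis a01 : 0 <= a <= 1.
Hypothesis theta1 : forall j, normc (theta j) <= 1.
Hypothesis tau_small : Lam^-1 + 5 * Lam ^- q < 1.

Variables (w : nat -> R[i]) (W delta : R).
Hypothesis wW : forall n, normc (w n) <= W.
Hypothesis delta0 : 0 < delta.

Definition orbit_sum N x := \sum_(0 <= n < N) w n * orbit_chr eta om n x.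

Lemma freq_bound_exists Nmax L :
  exists2 H, (L <= H)%N & forall n, (n < Nmax)%N -> bounded_freq H (eta n).
Proof.
exists (L + \sum_(n < Nmax) \sum_(i < d) `|eta n i ord0|)%N; first exact: leq_addr.
move=> n nN i; rewrite -abszE lez_nat (leq_trans _ (leq_addl _ _)) //.
by rewrite (bigD1 (Ordinal nN)) //= (bigD1 i) //= -addnA leq_addr.
Qed.

(** One grid is fine enough for all N <= K and L <= Lmax at once, so a single normalised positive
    functional plays the role of the measure and hides the grid, the budget and the frequencies. *)
Lemma riesz_functional K Lmax : exists Phi : ('cV[R]_d -> R) -> R,
  [/\ forall F G, (forall x, F x <= G x) -> Phi F <= Phi G,
      forall F G c, Phi (fun x => F x + c * G x) = Phi F + c * Phi G,
      Phi (fun=> 1) = 1,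
      forall N, (0 < N <= K)%N ->
        2 * delta * N%:R <= normc (riesz_total_mean r q a theta w N) ->
        Phi (fun x => (normc (orbit_sum N x) < delta * N%:R)%R%:R)
          <= 8 * q%:R * W ^+ 2 / (delta ^+ 2 * N%:R) &
      forall L c k, (0 < L <= Lmax)%N -> 2 * (U * L%:R) <= Lam ^+ (q * k) ->
        Phi (fejer L c) <= (1 + a) ^+ k * (L%:R ^+ d)^-1].
Proof.
(* The budget covers the K factors, one unit for conj X_m, and the margin 3 of
   [mean_orbit_riesz]. *)
pose Nmax := (r + q * K).+1; pose T := (K + 4)%N.
have [H LH etaH] := freq_bound_exists Nmax Lmax.
pose M := (T * H).+1.
pose P := riesz eta om r q a theta 0 K.
have jN j : (j <= K)%N -> (r + q * j < Nmax)%N.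
  by move=> jK; rewrite ltnS leq_add2l leq_mul2l jK orbT.
have P0 x : 0 <= P x by apply: riesz_ge0.
exists (fun F => grid_mean M (fun x => F x * P x)); split.
- by move=> F G FG; apply: ler_grid_mean => x; rewrite ler_wpM2r.
- move=> F G c; rewrite -grid_meanZ -grid_meanD; apply: eq_grid_mean => x.
  by rewrite mulrDl mulrA.
- rewrite (eq_grid_mean _ (G := P)) => [|x]; last by rewrite mul1r.
  apply: (mean_riesz size0 sizeN sizeD (T := T) (H := H) (Nmax := Nmax) (M := M)) => //.
    by rewrite subn0 leq_addr.
  by move=> j /ltnW; exact: jN.
- move=> N /andP[N0 NK] hN.
  apply: (riesz_chebyshev size0 sizeN sizeD size_double (T := T) (H := H) (Nmax := Nmax) (M := M)) => //.
- move=> L c k /andP[L0 LL] hk.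
  apply: (@fejer_riesz_mass R d size size0 sizeN sizeD M T H Nmax _ _ eta om Lam
    om1 etaH size_eta Lam1 r q a theta a01 theta1 tau_small L _ _ _ c (U * L%:R) k K) => //;
    first exact: leq_trans LL LH.
  + by rewrite /T addnS.
  + by rewrite /T addnS ltnS leq_addr.
  + by move=> j /ltnW; exact: jN.
  + by move=> l; exact: size_bounded.
  + by rewrite (le_trans hk) // ler_weXn2l // ?ltW // leq_addl.
Qed.

End RieszFunctional.

Lemma linear_functional_sum (R : realType) (X : Type) (Phi : (X -> R) -> R) :
  (forall F G c, Phi (fun x => F x + c * G x) = Phi F + c * Phi G) ->
  forall n (F : nat -> X -> R),
    Phi (fun x => \sum_(i < n) F i x) = \sum_(i < n) Phi (F i).
Proof.
move=> lin n F; elim: n => [|n IH].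
  (* Taking c = -1 gives Phi 0 = Phi 0 - Phi 0 = 0. *)
  rewrite big_ord0; have := lin (fun=> 0) (fun=> 0) (-1).
  have -> : (fun x : X => 0 + -1 * 0) = (fun=> 0 : R).
    by apply: funext => x; rewrite mulr0 addr0.
  have -> : (fun x => \sum_(i < 0) F i x) = (fun=> 0).
    by apply: funext => x; rewrite big_ord0.
  lra.
rewrite big_ord_recr /= -IH -[X in _ + X]mul1r -lin; congr Phi.
by apply: funext => x; rewrite big_ord_recr /= mul1r.
Qed.

(** * Choice of scales: the mass of a ball of radius rad is O(rad^sigma) *)

Section BallMass.
Variables (R : realType) (d : nat).
Variables (U Lam a sigma : R) (q : nat).
Hypotheses (d0 : (0 < d)%N) (U1 : 1 <= U) (Lam1 : 1 < Lam) (q0 : (0 < q)%N).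
Hypotheses (a01 : 0 <= a <= 1) (sigma0 : 0 <= sigma).
Local Notation eps := (d%:R - sigma).
Hypothesis eps0 : 0 <= eps.
Hypothesis a_small : 1 + a <= (Lam ^+ q) `^ eps.

Lemma exp_growth (y : R) : exists n, y <= (Lam ^+ q) ^+ n.
Proof.
have Q1 : 1 < Lam ^+ q by rewrite exprn_egt1 // -lt0n.
pose n := (Num.truncn (`|y| / (Lam ^+ q - 1))).+1.
have h0 : 0 < Lam ^+ q - 1 by rewrite subr_gt0.
exists n; rewrite (le_trans (ler_norm y)) //.
have : `|y| / (Lam ^+ q - 1) < n%:R.
  by rewrite truncnS_gt.
rewrite ltr_pdivrMr // => /ltW h; rewrite (le_trans h) //.
set X := Lam ^+ q - 1 in h h0 *.
(* Bernoulli's inequality. *)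
have bern m : 1 + m%:R * X <= (1 + X) ^+ m.
  elim: m => [|m IH]; first by rewrite mul0r addr0 expr0.
  rewrite exprS -natr1.
  have h1 : (1 + X) * (1 + m%:R * X) <= (1 + X) * (1 + X) ^+ m.
    by rewrite ler_wpM2l // addr_ge0 // ltW.
  have h2 : 0 <= m%:R * (X * X) by rewrite mulr_ge0 // mulr_ge0 // ltW.
  by lra.
have -> : Lam ^+ q = 1 + X by rewrite /X addrC subrK.
by have := bern n; lra.
Qed.

(** The least such k is taken. Minimality bounds Lam^(q (k - 1)) by 2 U L, hence (1 + a)^(k - 1) by
    (2 U L)^eps through [a_small]; the last factor 1 + a is at most 2. *)
Lemma scale_exists (L : nat) : (0 < L)%N -> exists2 k, 2 * (U * L%:R) <= Lam ^+ (q * k) &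
  (1 + a) ^+ k <= 2 * (2 * (U * L%:R)) `^ eps.
Proof.
move=> L0.
have [n0 hn0] := exp_growth (2 * (U * L%:R)).
have ex : exists n, 2 * (U * L%:R) <= (Lam ^+ q) ^+ n by exists n0.
case/andP: a01 => a0 a1.
have V1 : 1 <= 2 * (U * L%:R).
  have : 1 * 1 <= U * L%:R by rewrite ler_pM // ler1n.
  by lra.
exists (ex_minn ex); first by case: ex_minnP => m; rewrite exprM.
case: ex_minnP => -[|m] hm mmin.
  by rewrite expr0; have := ler_powR V1 eps0; rewrite powRr0; lra.
have hlt : (Lam ^+ q) ^+ m <= 2 * (U * L%:R).
  rewrite leNgt; apply/negP => /ltW /mmin; by rewrite ltnn.
rewrite exprS ler_pM ?exprn_ge0 //; try lra.
have Q0 : 0 <= Lam ^+ q by rewrite exprn_ge0 // ltW // (lt_trans ltr01).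
apply: (@le_trans _ _ (((Lam ^+ q) `^ eps) ^+ m)).
  apply: lerXn2r; [|by rewrite nnegrE powR_ge0|exact: a_small].
  by rewrite nnegrE addr_ge0.
rewrite -powR_mulrn ?powR_ge0 // -powRrM mulrC powRrM powR_mulrn //.
by apply: ge0_ler_powR => //; rewrite nnegrE; [exact: exprn_ge0 | exact: le_trans ler01 V1].
Qed.

(** The 8 is the 4 that normalises a Fejer kernel on a ball times the 2 of [scale_exists]; the last
    factor comes from 1 / L <= 16 d rad. *)
Definition ball_const : R := 8 * (2 * U) `^ eps * (16 * d%:R) `^ sigma.

(** L is the integer part of 1 / (8 d rad), the finest resolution at which the kernel stays above
    1/4 on the ball. The mass is then of order L^eps / L^d = L^-sigma, and rounding costs at most a
    factor 2 in L. *)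
Lemma resolution_exists (rad : R) : 0 < rad <= (8 * d%:R)^-1 ->
  exists L : nat, [/\ (0 < L)%N, rad <= (8 * d%:R * L%:R)^-1 &
  4 * (2 * (2 * (U * L%:R)) `^ eps * (L%:R ^+ d)^-1) <= ball_const * rad `^ sigma].
Proof.
case/andP => rad0 radd.
have dr : 0 < d%:R :> R by rewrite ltr0n.
have drad : 0 < 8 * d%:R * rad by rewrite !mulr_gt0.
pose t := (8 * d%:R * rad)^-1; pose L := Num.truncn t.
have t1 : 1 <= t.
  rewrite /t invf_ge1 //; move: radd.
  by rewrite -[leRHS]div1r ler_pdivlMr ?mulr_gt0 // mulrC.
have L0 : (0 < L)%N by rewrite /L truncn_gt0.
have Lt : L%:R <= t by rewrite truncn_le // (le_trans ler01).
have tL : t <= 2 * L%:R.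
  have : t < L.+1%:R by exact: truncnS_gt.
  rewrite -natr1; have : 1 <= L%:R :> R by rewrite ler1n.
  lra.
have Lr : 0 < L%:R :> R by rewrite ltr0n.
exists L; split => //.
  rewrite -[leRHS]div1r ler_pdivlMr ?mulr_gt0 //; move: Lt.
  by rewrite /t -[leRHS]div1r ler_pdivlMr //; lra.
have -> : (2 * (U * L%:R)) `^ eps = (2 * U) `^ eps * L%:R `^ eps.
  by rewrite mulrA powRM // mulr_ge0 // (le_trans ler01 U1).
have -> : L%:R `^ eps = L%:R ^+ d / L%:R `^ sigma.
  by rewrite powRB ?powR_mulrn // (gt_eqF Lr) /= implybT.
have Ls : 0 < L%:R `^ sigma by rewrite powR_gt0.
have key : (L%:R `^ sigma)^-1 <= (16 * d%:R) `^ sigma * rad `^ sigma.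
  rewrite -[leLHS]div1r ler_pdivrMr // -!powRM ?mulr_ge0 ?(ltW rad0) //.
  have h : 1 <= 16 * d%:R * rad * L%:R.
    by move: tL; rewrite /t -[leLHS]div1r ler_pdivrMr //; lra.
  have := ge0_ler_powR sigma0 _ _ h; rewrite powR1 !nnegrE; apply => //.
  exact: le_trans ler01 h.
have C0 : 0 <= 8 * (2 * U) `^ eps by rewrite mulr_ge0 ?powR_ge0.
have := ler_wpM2l C0 key; rewrite [X in _ <= X]mulrA -/ball_const.
have -> : 4 * (2 * ((2 * U) `^ eps * (L%:R ^+ d / L%:R `^ sigma)) / L%:R ^+ d)
    = 8 * (2 * U) `^ eps / L%:R `^ sigma.
  by field; rewrite gt_eqF // expf_neq0 // gt_eqF.
done.
Qed.

End BallMass.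

(** * Upper limits of sequences *)

Section LimSup.
Variable R : realType.
Local Open Scope ereal_scope.

Lemma limn_esup_gt0 (u : nat -> R) : 0 < limn_esup (fun N => (u N)%:E) ->
  exists2 delta : R, (0 < delta)%R & forall N0, exists2 N, (N0 <= N)%N & (delta <= u N)%R.
Proof.
move=> h.
have [delta d0 dl] : exists2 delta : R, (0 < delta)%R & delta%:E < limn_esup (fun N => (u N)%:E).
  case E : (limn_esup _) h => [l| |] //.
    rewrite lte_fin => l0; exists (l / 2)%R; first by rewrite divr_gt0.
    by rewrite lte_fin ltr_pdivrMr // ltr_pMr // ltr1n.
  by exists 1%R => //; rewrite ltry.
exists delta => // N0; apply: contrapT => hN.
move: dl; apply/negP; rewrite -leNgt.
pose A := [set n | (N0 <= n)%N].
apply: (@le_trans _ _ (ereal_sup [set (u n)%:E | n in A])).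
  by apply: ereal_inf_lbound; exists A => //; exists N0.
apply: ge_ereal_sup => _ [n An <-]; rewrite lee_fin leNgt; apply/negP => /ltW dn.
by apply: hN; exists n.
Qed.

Lemma limn_esup_ge (u : nat -> \bar R) l :
  (forall N0, exists2 N, (N0 <= N)%N & l <= u N) -> l <= limn_esup u.
Proof.
move=> h; apply: le_ereal_inf_tmp => _ [A [N0 _ N0A] <-].
have [N N0N lN] := h N0.
by apply: (le_trans lN); apply: ereal_sup_ubound; exists N => //; exact: N0A.
Qed.

End LimSup.

(** * A residue class carrying its share of the weight *)

Section ResidueClass.
Variable R : realType.

(** Pigeonhole: if every class eventually fell short of its share, adding the q strict inequalities
    beyond the largest threshold would contradict the lower bound for the full sum. *)
Lemma residue_class (v : nat -> R) (delta : R) q : (0 < q)%N ->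
  (forall N0, exists2 N, (N0 <= N)%N & delta <= N%:R^-1 * \sum_(0 <= n < N) v n) ->
  exists2 r, (r < q)%N & forall N0, exists2 N, (N0 <= N)%N &
    delta * N%:R <= q%:R * \sum_(0 <= n < N | (n %% q == r)%N) v n.
Proof.
move=> q0 hv; apply: contrapT => hr.
have h (r : 'I_q) : exists N0, forall N, (N0 <= N)%N ->
    q%:R * \sum_(0 <= n < N | (n %% q == r)%N) v n < delta * N%:R.
  apply: contrapT => hN; apply: hr; exists r => // N0.
  apply: contrapT => hN'; apply: hN; exists N0 => N N0N.
  by rewrite ltNge; apply/negP => hle; apply: hN'; exists N.
have [F hF] := choice h.
have [N hN] := hv (\max_r F r).+1.
have N0 : (0 < N)%N by rewrite (leq_trans _ hN).
rewrite ler_pdivlMl ?ltr0n // => hle.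
have : q%:R * \sum_(0 <= n < N) v n < q%:R * (N%:R * delta).
  have -> : \sum_(0 <= n < N) v n
      = \sum_(r < q) \sum_(0 <= n < N | (n %% q == r)%N) v n.
    rewrite (exchange_big_dep predT) //=; apply: eq_bigr => n _.
    rewrite (big_pred1 (Ordinal (ltn_pmod n q0))) //.
  rewrite mulr_sumr.
  have -> : q%:R * (N%:R * delta) = \sum_(r < q) (delta * N%:R).
    by rewrite sumr_const card_ord -[RHS]mulr_natl [delta * _]mulrC.
  apply: ltr_sum => [|r _].
    by apply/hasP; exists (Ordinal q0) => //; rewrite mem_index_enum.
  by apply: hF; rewrite (leq_trans _ (ltnW hN)) //; exact: leq_bigmax.
move=> /lt_le_trans/(_ (ler_wpM2l (ler0n _ q) hle)).
by rewrite ltxx.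
Qed.

End ResidueClass.

(** * Continuity and open sets on the torus through lifts to R^d *)

Section UniformContinuity.
Variables (R : realType) (d : nat).
Implicit Types (F G : 'cV[R]_d -> R[i]) (k : 'cV[int]_d).

Definition unif_cont F := forall e : R, 0 < e -> exists2 delta : R, 0 < delta &
  forall u v, `|u - v| < delta -> normc (F u - F v) < e.

Lemma e1_near0 (e : R) : 0 < e -> exists2 delta : R, 0 < delta &
  forall s, `|s| < delta -> normc (e1 s - 1) < e.
Proof.
move=> e0; have p0 := pi_gt0 R.
have e20 : 0 < e / 2 by rewrite divr_gt0.
have key (s : R) : normc (e1 s - 1) <= `|cos (2 * pi * s) - 1| + `|sin (2 * pi * s)|.
  by rewrite (le_trans (normc_le_ReIm _)) //= oppr0 addr0.
have cc : cos t @[t --> (0 : R)] --> (1 : R) by rewrite -[X in _ --> X]cos0; exact: continuous_cos.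
have cs : sin t @[t --> (0 : R)] --> (0 : R) by rewrite -[X in _ --> X]sin0; exact: continuous_sin.
have /cvgrPdist_lt /(_ _ e20) /nbhs_ballP[d1 d10 h1] := cc.
have {}d10 : 0 < d1 := d10.
have /cvgrPdist_lt /(_ _ e20) /nbhs_ballP[d2 d20 h2] := cs.
have {}d20 : 0 < d2 := d20.
exists (Num.min d1 d2 / (2 * pi)).
  by rewrite divr_gt0 ?lt_min ?d10 ?d20 // mulr_gt0.
move=> s; rewrite ltr_pdivlMr ?mulr_gt0 // lt_min => /andP[s1 s2].
apply: (le_lt_trans (key s)).
have hs : `|2 * pi * s| = `|s| * (2 * pi).
  by rewrite mulrC normrM [X in _ * X]gtr0_norm // mulr_gt0.
rewrite [e]splitr; apply: ltrD.
  by rewrite distrC; apply: h1; rewrite /ball /= sub0r normrN hs.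
by rewrite -normrN -[- sin _]add0r; apply: h2; rewrite /ball /= sub0r normrN hs.
Qed.

Lemma unif_contZ (c : R[i]) F : unif_cont F -> unif_cont (fun x => c * F x).
Proof.
move=> cF e e0; have c0 : 0 < normc c + 1 by rewrite ltr_wpDl // normc_ge0.
have [delta d0 hd] := cF (e / (normc c + 1)) (divr_gt0 e0 c0).
exists delta => // u v /hd; rewrite ltr_pdivlMr // => h.
rewrite -mulrBr ComplexField.Normc.normcM mulrC (le_lt_trans _ h) //.
by rewrite ler_wpM2l ?normc_ge0 // lerDl.
Qed.

Lemma unif_contD F G : unif_cont F -> unif_cont G -> unif_cont (fun x => F x + G x).
Proof.
move=> cF cG e e0; have e20 : 0 < e / 2 by rewrite divr_gt0.
have [d1 d10 h1] := cF _ e20; have [d2 d20 h2] := cG _ e20.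
exists (Num.min d1 d2); first by rewrite lt_min d10.
move=> u v; rewrite lt_min => /andP[/h1 uv1 /h2 uv2].
rewrite opprD addrACA (le_lt_trans (ler_normcD _ _)) // [e]splitr.
exact: ltrD.
Qed.

Lemma unif_cont_sum (I : Type) (r : seq I) (F : I -> 'cV[R]_d -> R[i]) :
  (forall i, unif_cont (F i)) -> unif_cont (fun x => \sum_(i <- r) F i x).
Proof.
move=> cF; elim: r => [|i r IH] e e0.
  by exists 1 => // u v _; rewrite !big_nil subr0 ComplexField.Normc.normc0.
have [delta d0 h] := unif_contD (cF i) IH e0.
by exists delta => // u v /h; rewrite !big_cons.
Qed.

Lemma pairing_le k (x : 'cV[R]_d) : `|pairing k x| <= (\sum_i `|(k i 0)%:~R|) * `|x|.
Proof.
rewrite (le_trans (ler_norm_sum _ _ _)) // mulr_suml; apply: ler_sum => i _.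
by rewrite normrM ler_wpM2l // mx_coord_le.
Qed.

Lemma unif_cont_chr k : unif_cont (chr k).
Proof.
move=> e e0; have [delta d0 hd] := e1_near0 e0.
pose S : R := \sum_i `|(k i 0)%:~R|.
have S0 : 0 < S + 1 by rewrite ltr_wpDl // sumr_ge0.
exists (delta / (S + 1)); first by rewrite divr_gt0.
move=> u v; rewrite ltr_pdivlMr // => uv.
have -> : chr k u = chr k (u - v) * chr k v.
  by rewrite /chr -e1D -pairingDr subrK.
rewrite -[X in _ * _ - X]mul1r -mulrBl ComplexField.Normc.normcM normc_chr mulr1.
apply: hd; rewrite (le_lt_trans (pairing_le _ _)) // (le_lt_trans _ uv) //.
by rewrite mulrC ler_wpM2l // lerDl.
Qed.

Lemma torus_open_of (U : set (torus R d)) :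
  (forall u : 'cV[R]_d, U (\pi_(torus R d) u) -> exists2 e : R, 0 < e &
     forall v, `|u - v| < e -> U (\pi_(torus R d) v)) -> open U.
Proof.
move=> hU; apply/torus_openP; rewrite openE => u /hU[e e0 h].
by rewrite /interior -nbhs_ballE; exists e => //= v; rewrite mx_norm_ball; exact: h.
Qed.

Lemma open_torus_ball (c : torus R d) (rad : R) : open [set y | torus_dist c y < rad].
Proof.
apply: torus_open_of => u /= hu; exists (rad - torus_dist c (\pi u)).
  by rewrite subr_gt0.
move=> v; rewrite ltrBrDl => h.
rewrite (le_lt_trans (torus_dist_triangle (\pi u) _ _)) //.
by rewrite (le_lt_trans _ h) // lerD2l torus_dist_pi.
Qed.

Lemma continuous_torus_complex (f : torus R d -> R[i]^o) :
  unif_cont (fun u => f (\pi_(torus R d) u)) -> continuous f.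
Proof.
move=> cf x.
apply/(@cvgrPdist_lt _ R[i]^o _ _ (nbhs_filter x)) => e e0.
have e0' : 0 < complex.Re e by move: e0; rewrite ltcE /= => /andP[].
have [delta d0 h] := cf _ e0'.
rewrite near_simpl /= /prop_near1 -nbhs_ballE; exists delta => //= y.
rewrite ballEmdist /= -{1 2}(reprK x) => /torus_dist_lt[v <- uv].
rewrite normcE_norm (lt_le_trans (y := (complex.Re e)%:C)) //.
  by rewrite ltcR; apply: h.
by rewrite lecE /= lexx andbT; move: e0; rewrite ltcE /= => /andP[].
Qed.

End UniformContinuity.

(** * A coordinate character along the orbits of the affine map *)

Section ToralOrbits.
Variables (R : realType) (d : nat) (B : 'M[int]_d) (b : 'cV[R]_d).
Variables (lam : R[i]) (u : 'I_d -> R[i]) (i0 : 'I_d).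
Hypothesis u_eigen : forall i, \sum_j (B i j)%:~R * u j = lam * u i.
Hypothesis u_i0 : u i0 = 1.
Local Notation Lam := (normc lam).
Local Notation T := (torus_affine B b).
Local Notation torus := (torus R d).

Definition freq_size (k : 'cV[int]_d) : R := normc (\sum_i (k i 0)%:~R * u i).

Lemma freq_size0 : freq_size 0 = 0.
Proof.
by rewrite /freq_size big1 ?ComplexField.Normc.normc0 // => i _; rewrite mxE mul0r.
Qed.

Lemma freq_sizeN k : freq_size (- k) = freq_size k.
Proof.
rewrite /freq_size -normc_opp -sumrN; congr normc; apply: eq_bigr => i _.
by rewrite mxE rmorphN mulNr opprK.
Qed.

Lemma freq_form_add (k l : 'cV[int]_d) : \sum_i ((k + l) i 0)%:~R * u i
  = \sum_i (k i 0)%:~R * u i + \sum_i (l i 0)%:~R * u i.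
Proof.
by rewrite -big_split /=; apply: eq_bigr => i _; rewrite mxE rmorphD mulrDl.
Qed.

Lemma freq_sizeD k l : freq_size (k + l) <= freq_size k + freq_size l.
Proof. by rewrite /freq_size freq_form_add ler_normcD. Qed.

Lemma freq_size_double k : freq_size (k + k) = 2 * freq_size k.
Proof.
rewrite /freq_size freq_form_add; set z := \sum_i _.
have -> : z + z = (2%:R : R)%:C * z by rewrite rmorph_nat mulr_natl.
by rewrite ComplexField.Normc.normcM normc_real normr_nat.
Qed.

Definition freq_size_const : R := 1 + \sum_i normc (u i).

Lemma freq_size_const_ge1 : 1 <= freq_size_const.
Proof. by rewrite lerDl sumr_ge0 // => i _; exact: normc_ge0. Qed.

Lemma freq_size_bounded S k : bounded_freq S k -> freq_size k <= freq_size_const * S%:R.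
Proof.
move=> bk; rewrite /freq_size (le_trans (normc_sum _ _ _)) //.
apply: (@le_trans _ _ (\sum_i normc (u i) * S%:R)).
  apply: ler_sum => i _; rewrite ComplexField.Normc.normcM mulrC.
  rewrite ler_wpM2l ?normc_ge0 //.
  have -> : ((k i 0)%:~R : R[i]) = ((k i 0)%:~R : R)%:C by rewrite rmorph_int.
  by rewrite normc_real -intr_norm; have := bk i; rewrite -(ler_int R).
by rewrite -mulr_suml ler_wpM2r // lerDr.
Qed.

Definition coord_freq : 'cV[int]_d := \col_i (i == i0)%:Z.
Definition orbit_freq n : 'cV[int]_d := iter n (mulmx B^T) coord_freq.
(** The unimodular constant contributed by the translation b, from chr(eta_m)(B v + b) = chr(B^T
    eta_m)(v) chr(eta_m)(b). *)
Fixpoint orbit_phase n : R[i] :=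
  if n is m.+1 then orbit_phase m * chr (orbit_freq m) b else 1.

Lemma normc_orbit_phase n : normc (orbit_phase n) = 1.
Proof.
elim: n => [|n IH] /=; first exact: ComplexField.Normc.normc1.
by rewrite ComplexField.Normc.normcM IH normc_chr mulr1.
Qed.

Lemma freq_form_mul (k : 'cV[int]_d) : \sum_i ((B^T *m k) i 0)%:~R * u i
  = lam * \sum_i (k i 0)%:~R * u i.
Proof.
under eq_bigr do rewrite mxE rmorph_sum mulr_suml.
rewrite exchange_big /= mulr_sumr; apply: eq_bigr => i _.
rewrite mulrCA -u_eigen mulr_sumr; apply: eq_bigr => j _.
by rewrite mxE intrM -mulrA mulrCA.
Qed.

(** Since <B^T k, u> = <k, B u> = lam <k, u>, each step multiplies the size by |lam|; the initial
    size is |u_i0| = 1. *)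
Lemma freq_size_orbit n : freq_size (orbit_freq n) = Lam ^+ n.
Proof.
elim: n => [|n IH].
  rewrite expr0 /freq_size (bigD1 i0) //= big1 => [|i /negbTE ni].
    by rewrite !mxE eqxx mul1r addr0 u_i0 ComplexField.Normc.normc1.
  by rewrite !mxE ni mul0r.
by rewrite /freq_size /= freq_form_mul ComplexField.Normc.normcM -/(freq_size _) IH exprS.
Qed.

(** Depends on i0 only: the same function serves every weight and every exponent below d. *)
Definition coord_chr (y : torus) : R[i]^o := chr coord_freq (repr y).

Lemma coord_chr_pi v : coord_chr (\pi v) = chr coord_freq v.
Proof. by apply: chr_pi; rewrite reprK. Qed.

Lemma coord_chr_orbit n v :
  coord_chr (iter n T (\pi v)) = orbit_chr orbit_freq orbit_phase n v.
Proof.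
rewrite /orbit_chr; elim: n v => [|n IH] v.
  by rewrite /= coord_chr_pi mul1r.
rewrite iterSr torus_affineE IH /= [chr (orbit_freq n) _]/chr pairingDr e1D.
by rewrite pairing_mul mulrAC mulrA.
Qed.

Lemma coord_chr_continuous : continuous coord_chr.
Proof.
apply: continuous_torus_complex => e e0.
have [delta d0 h] := unif_cont_chr coord_freq e0.
by exists delta => // x y /h; rewrite !coord_chr_pi.
Qed.

Lemma unif_cont_orbit_sum w N : unif_cont (orbit_sum orbit_freq orbit_phase w N).
Proof.
by apply: unif_cont_sum => n; apply/unif_contZ/unif_contZ/unif_cont_chr.
Qed.

Lemma coord_chr_sum w N v : \sum_(0 <= n < N) w n * coord_chr (iter n T (\pi v))
  = orbit_sum orbit_freq orbit_phase w N v.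
Proof. by apply: eq_bigr => n _; rewrite coord_chr_orbit. Qed.

Lemma open_small_sum w N (c : R) :
  open [set y : torus | normc (\sum_(0 <= n < N) w n * coord_chr (iter n T y)) < c].
Proof.
apply: torus_open_of => v /=; rewrite coord_chr_sum => hv.
have e0 : 0 < c - normc (orbit_sum orbit_freq orbit_phase w N v) by rewrite subr_gt0.
have [delta d0 h] := unif_cont_orbit_sum w N e0.
exists delta => // v' /h; rewrite coord_chr_sum => h'.
have := ler_normcB (orbit_sum orbit_freq orbit_phase w N v') (orbit_sum orbit_freq orbit_phase w N v).
rewrite -[normc (_ - _)]normc_opp opprB => h2.
move: h' h2; lra.
Qed.

End ToralOrbits.

(** * Finite subcovers of countable open covers of the torus *)

Section FiniteCover.
Variables (R : realType) (d : nat).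

(** Otherwise the complements of the finite unions generate a proper filter; a cluster point of it
    lies in some U_i, whose complement belongs to the filter. *)
Lemma torus_finite_subcover (U : nat -> set (torus R d)) :
  (forall i, open (U i)) -> (forall x, exists i, U i x) ->
  exists n, forall x, exists2 i, (i < n)%N & U i x.
Proof.
move=> oU cU; apply: contrapT => hn.
have ex n : exists x, forall i, (i < n)%N -> ~ U i x.
  apply: contrapT => hx; apply: hn; exists n => x; apply: contrapT => hi.
  by apply: hx; exists x => i ilt Ui; apply: hi; exists i.
pose F := [set A : set (torus R d) |
  exists n, forall x, (forall i, (i < n)%N -> ~ U i x) -> A x].
have FF : ProperFilter F.
  split; first by move=> [n hF]; have [x /hF] := ex n.
  split; first by exists 0%N.
    move=> P Q [n hP] [m hQ]; exists (maxn n m) => x hx; split.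
      by apply: hP => i ilt; apply: hx; rewrite leq_max ilt.
    by apply: hQ => i ilt; apply: hx; rewrite leq_max ilt orbT.
  by move=> P Q PQ [n hP]; exists n => x /hP /PQ.
have [|x [_ xF]] := @torus_compact R d F FF; first by exists 0%N.
have [i Ui] := cU x.
have [|y [/= nU Uy]] := xF (~` U i) (U i) _ (open_nbhs_nbhs (conj (oU i) Ui)).
  by exists i.+1 => z; apply.
exact: nU.
Qed.

End FiniteCover.

(** * Lower bound for covers of the set of correlated points *)

Section CoveringContent.
Variables (R : realType) (d : nat) (B : 'M[int]_d) (b : 'cV[R]_d).
Variables (lam : R[i]) (u : 'I_d -> R[i]) (i0 : 'I_d).
Hypothesis u_eigen : forall i, \sum_j (B i j)%:~R * u j = lam * u i.
Hypothesis u_i0 : u i0 = 1.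
Local Notation Lam := (normc lam).
Hypothesis Lam1 : 1 < Lam.
Local Notation T := (torus_affine B b).
Local Notation torus := (torus R d).
Local Notation f := (@coord_chr R d i0).

Lemma gap_exists : exists2 q, (0 < q)%N & Lam^-1 + 5 * Lam ^- q < 1.
Proof.
have L0 : 0 < Lam by rewrite (lt_trans ltr01).
have i1 : Lam^-1 < 1 by rewrite invf_lt1.
have h0 : 0 < 1 - Lam^-1 by rewrite subr_gt0.
have [n] := exp_growth Lam1 (ltn0Sn 0) (5 / (1 - Lam^-1)).
rewrite expr1 => hn; exists n.+1 => //.
have : 5 / (1 - Lam^-1) < Lam ^+ n.+1.
  by rewrite (le_lt_trans hn) // exprS ltr_pMl // exprn_gt0.
rewrite ltr_pdivrMr // -ltr_pdivrMl ?exprn_gt0 // mulrC; lra.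
Qed.

(** The phase theta_j = w_n / |w_n| at a node n turns w_n conj(theta_j) into |w_n|, so the
    contributions of the nodes add without cancellation. *)
Lemma total_mean_lower (w : nat -> R[i]) r q (a : R) N : (r < q)%N -> 0 <= a ->
  normc (riesz_total_mean r q a (fun j => w (r + q * j)%N / (normc (w (r + q * j)%N))%:C) w N)
  = a / 2 * \sum_(0 <= n < N | (n %% q == r)%N) normc (w n).
Proof.
move=> rq a0; have q0 : (0 < q)%N by rewrite (leq_trans _ rq).
rewrite /riesz_total_mean.
have -> : \sum_(0 <= n < N) w n * riesz_mean r q a
     (fun j => w (r + q * j)%N / (normc (w (r + q * j)%N))%:C) n
   = (a / 2 * \sum_(0 <= n < N | (n %% q == r)%N) normc (w n))%:C.
  rewrite real_complexM rmorph_sum /= mulr_sumr [RHS]big_mkcond /=.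
  apply: eq_bigr => n _; rewrite /riesz_mean.
  have -> : (r <= n)%N && (q %| n - r)%N = (n %% q == r)%N.
    case: (leqP r n) => [rn|nr] /=.
      by rewrite -(eqn_mod_dvd q rn) (modn_small rq) eq_sym.
    by rewrite modn_small ?(ltn_trans nr rq) // ltn_eqF.
  case: ifPn => [/eqP nr|_]; last by rewrite mulr0.
  have -> : (r + q * ((n - r) %/ q))%N = n.
    have hd := divn_eq n q; rewrite nr in hd.
    rewrite {2}hd addnC mulnC; congr (_ * _ + _)%N.
    by rewrite {1}hd addnK mulnK.
  rewrite conjcM mulrCA; congr (_ * _).
  have -> : conjc ((normc (w n))%:C^-1) = (normc (w n))%:C^-1.
    by rewrite -fmorphV conjc_real.
  rewrite mulrA normc_sqr.
  (* With the convention 0^-1 = 0, theta vanishes where w does and the identity persists. *)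
  have [->|wn0] := eqVneq (normc (w n)) 0; first by rewrite expr0n /= mul0r.
  by rewrite expr2 real_complexM mulfK // eq_complex /= (negbTE wn0).
rewrite normc_real ger0_norm // mulr_ge0 ?divr_ge0 // sumr_ge0 // => n _.
exact: normc_ge0.
Qed.

(** The balls, together with the open sets where the sum at time N_j is small, cover the torus. The
    functional gives the small-sum sets mass at most 1/2 in total, so the balls carry at least 1/2,
    while each has mass at most C1 rad^sigma. *)
Lemma covering_content (w : nat -> R[i]) (sigma : R) : nontrivial_weight w ->
  0 <= sigma < d%:R -> exists2 c0 : R, 0 < c0 &
  forall (c : nat -> torus) (rad : nat -> R),
    (forall i, 0 < rad i <= (8 * d%:R)^-1) ->
    (forall x, correlated T w f x -> exists i, torus_dist (c i) x < rad i) ->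
    exists n, c0 <= \sum_(i < n) rad i `^ sigma.
Proof.
move=> [[W wW] /limn_esup_gt0[delta0 d00 hw]] /andP[s0 sd].
have [q q0 tau_small] := gap_exists.
have [r rq hr] := residue_class q0 hw.
have d_gt0 : (0 < d)%N by rewrite (leq_trans _ (ltn_ord i0)).
have eps0 : 0 < d%:R - sigma by rewrite subr_gt0.
have qr : 0 < q%:R :> R by rewrite ltr0n.
pose Q := (Lam ^+ q) `^ (d%:R - sigma).
have Q1 : 1 < Q.
  have := gt0_ltr_powR eps0 _ _ (_ : 1 < Lam ^+ q); rewrite powR1; apply.
  - by rewrite nnegrE.
  - by rewrite nnegrE exprn_ge0 // normc_ge0.
  - by rewrite exprn_egt1 // -lt0n.
(* The largest amplitude a <= 1 with 1 + a <= Q. *)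
pose a := Num.min 1 (Q - 1).
have a0 : 0 < a by rewrite lt_min ltr01 subr_gt0.
have a01 : 0 <= a <= 1 by rewrite ltW // ge_min lexx.
have a_small : 1 + a <= Q by rewrite -lerBrDl ge_min lexx orbT.
pose theta j := w (r + q * j)%N / (normc (w (r + q * j)%N))%:C.
have theta1 j : normc (theta j) <= 1.
  rewrite /theta ComplexField.Normc.normcM ComplexField.Normc.normcV normc_real.
  rewrite ger0_norm ?normc_ge0 //.
  have [->|wn0] := eqVneq (normc (w (r + q * j)%N)) 0; first by rewrite mul0r.
  by rewrite mulfV.
(* Chosen so that 2 delta N is a / 2 times delta0 N / q, the share of the class r. *)
pose delta := a * delta0 / (4 * q%:R).
have delta_gt0 : 0 < delta by rewrite divr_gt0 ?mulr_gt0.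
pose C := 8 * q%:R * W ^+ 2 / delta ^+ 2.
pose U := freq_size_const u.
(* Times N_j so large that the Chebyshev bounds sum to at most 1/2 over j; they depend on the weight
   and sigma but not on the cover. *)
have goodN j : exists N, [/\ (j < N)%N, C / N%:R <= 2^-1 ^+ j.+2 &
    2 * delta * N%:R <= normc (riesz_total_mean r q a theta w N)].
  have [N jN hN] := hr (maxn j.+1 (Num.truncn `|C / 2^-1 ^+ j.+2|).+1).
  exists N; split; first by rewrite (leq_trans _ jN) // leq_max leqnn.
    have N0 : 0 < N%:R :> R by rewrite ltr0n (leq_trans _ jN) // leq_max.
    rewrite ler_pdivrMr // mulrC -ler_pdivrMr ?exprn_gt0 ?invr_gt0 //.
    rewrite (le_trans (ler_norm _)) // (le_trans (ltW (truncnS_gt _))) //.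
    by rewrite ler_nat (leq_trans _ jN) // leq_max leqnn orbT.
  rewrite total_mean_lower //; last exact: ltW.
  have a2q : 0 <= a / (2 * q%:R) by rewrite divr_ge0 ?mulr_ge0 // ltW.
  have := ler_wpM2l a2q hN; set v := \sum_(_ <= _ < _ | _) _.
  have -> : 2 * delta * N%:R = a / (2 * q%:R) * (delta0 * N%:R).
    by rewrite /delta; field; rewrite gt_eqF.
  have -> : a / (2 * q%:R) * (q%:R * v) = a / 2 * v.
    by field; rewrite gt_eqF.
  by [].
have [Ns hNs] := choice goodN.
pose C1 := ball_const d U sigma.
have U1 : 1 <= U by exact: freq_size_const_ge1.
(* From 1 <= 1/2 + C1 S, where S is the sum of the rad^sigma; 1 + C1 keeps the denominator
   positive. *)
exists (2 * (1 + C1))^-1.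
  rewrite invr_gt0 mulr_gt0 // ltr_wpDr // /C1 /ball_const.
  by rewrite !mulr_ge0 ?powR_ge0.
move=> c rad hrad hcov.
pose small j := [set y : torus |
  normc (\sum_(0 <= n < Ns j) w n * f (iter n T y)) < delta * (Ns j)%:R].
have [||n hn] := @torus_finite_subcover R d
    (fun j => small j `|` [set y | torus_dist (c j) y < rad j]).
- by move=> j; apply: openU; [exact: open_small_sum | exact: open_torus_ball].
(* A point in no small-sum set has averages at least delta at all times N_j > j, hence is correlated
   and lies in a ball. *)
- move=> x; have [[j xj]|hx] := pselect (exists j, small j x); first by exists j; left.
  have [|i xi] := hcov x; last by exists i; right.
  rewrite /correlated; apply: (@lt_le_trans _ _ delta%:E); first by rewrite lte_fin.
  apply: limn_esup_ge => N0; exists (Ns N0).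
    by have [/ltnW] := hNs N0.
  have [jN _ _] := hNs N0.
  rewrite lee_fin ler_pdivlMl ?ltr0n ?(leq_trans _ jN) // mulrC leNgt.
  by apply/negP => h; apply: hx; exists N0.
exists n.
have hres j : exists L : nat, [/\ (0 < L)%N, rad j <= (8 * d%:R * L%:R)^-1 &
  4 * (2 * (2 * (U * L%:R)) `^ (d%:R - sigma) * (L%:R ^+ d)^-1) <= C1 * rad j `^ sigma].
  exact: resolution_exists.
have [Ls hLs] := choice hres.
have [Phi [Pmono Plin P1 Pcheb Pfejer]] :=
  @riesz_functional R d (freq_size u) (freq_size0 u) (freq_sizeN u) (freq_sizeD u)
    (freq_size_double u) U (@freq_size_bounded R d u) (orbit_freq B i0) (orbit_phase B b i0)
    Lam (normc_orbit_phase B b i0) (freq_size_orbit u_eigen u_i0) Lam1 r q a theta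
    q0 a01 theta1 tau_small w W delta wW delta_gt0
    (\max_(j < n) Ns j) (\max_(j < n) Ls j).
pose S j v := orbit_sum (orbit_freq B i0) (orbit_phase B b i0) w (Ns j) v.
(* Majorant of the indicator of the j-th set of the cover: 4 times the kernel is at least 1 on the
   ball. *)
pose F j v : R := (normc (S j v) < delta * (Ns j)%:R)%R%:R
  + 4 * fejer (Ls j) (repr (c j)) v.
have F0 j v : 0 <= F j v.
  by rewrite addr_ge0 // mulr_ge0 // sqr_ge0.
have hF v : 1 <= \sum_(j < n) F j v.
  have [j jn hj] := hn (\pi_torus v).
  rewrite (bigD1 (Ordinal jn)) //=; apply: (@le_trans _ _ (F j v)); last first.
    by rewrite lerDl sumr_ge0.
  case: hj => [|hj].
    rewrite /small /= (coord_chr_sum B b i0) /F /S => ->.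
    by rewrite lerDl mulr_ge0 // sqr_ge0.
  have {hj} : torus_dist (\pi_torus (repr (c j))) (\pi_torus v) < rad j by rewrite reprK.
  case/torus_dist_lt => v' vv' hv'.
  have [Lj0 Lrad _] := hLs j.
  have : 4^-1 <= fejer (Ls j) (repr (c j)) v.
    rewrite -(fejer_pi _ _ vv'); apply: fejer_ge => // i.
    have -> : v' i 0 - repr (c j) i 0 = (v' - repr (c j)) i 0 by rewrite !mxE.
    by rewrite (le_trans (mx_coord_le _ _)) // distrC (le_trans (ltW hv')).
  have : 0 <= (normc (S j v) < delta * (Ns j)%:R)%R%:R :> R by [].
  rewrite /F; lra.
have := Pmono (fun=> 1) (fun v => \sum_(j < n) F j v) hF.
rewrite P1 (linear_functional_sum Plin) => h1.
have h2 (j : 'I_n) : Phi (F j) <= 2^-1 ^+ j.+2 + C1 * rad j `^ sigma.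
  rewrite Plin; have [jN hC hmean] := hNs j; have [L0 _ hLj] := hLs j.
  apply: lerD.
    apply: le_trans (Pcheb (Ns j) _ hmean) _.
      by apply/andP; split; [exact: leq_trans jN | exact: (leq_bigmax j)].
    have -> // : 8 * q%:R * W ^+ 2 / (delta ^+ 2 * (Ns j)%:R) = C / (Ns j)%:R.
    by rewrite /C -[RHS]mulrA -invfM.
  apply: le_trans hLj; rewrite ler_pM2l //.
  have [k hk1 hk2] := scale_exists U1 Lam1 q0 a01 (ltW eps0) a_small L0.
  have hk := Pfejer (Ls j) (repr (c j)) k _ hk1.
  apply: le_trans (hk _) _; first by rewrite L0; exact: (leq_bigmax j).
  by rewrite ler_wpM2r // invr_ge0 exprn_ge0.
have h3 : \sum_(j < n) (2^-1 : R) ^+ j.+2 <= 2^-1.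
  have : \sum_(j < n) (2^-1 : R) ^+ j.+2 = 2^-1 - 2^-1 ^+ n.+1.
    elim: (n) => [|m IH]; first by rewrite big_ord0 expr1 subrr.
    by rewrite big_ord_recr /= IH !exprS; field.
  move=> ->; rewrite gerBl exprn_ge0 // invr_ge0 //.
have {}h2 : \sum_(j < n) Phi (F j) <= \sum_(j < n) 2^-1 ^+ j.+2 + C1 * \sum_(j < n) rad j `^ sigma.
  by rewrite mulr_sumr -big_split /=; apply: ler_sum => j _; exact: h2.
set Sr := \sum_(i < n) rad i `^ sigma in h2 *.
have C10 : 0 <= C1 by rewrite /C1 /ball_const !mulr_ge0 ?powR_ge0.
have Sr0 : 0 <= Sr by apply: sumr_ge0 => j _; exact: powR_ge0.
rewrite -div1r ler_pdivrMr; last by rewrite mulr_gt0 // ltr_wpDr.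
have h4 := le_trans h1 h2.
move: h3 h4; lra.
Qed.

End CoveringContent.

(** * Hausdorff dimension of subsets of the torus *)

Section HausdorffTorus.
Variables (R : realType) (d : nat).
Hypothesis d0 : (0 < d)%N.
Local Notation torus := (torus R d).
Implicit Types (U A : set torus).

Lemma diameter_ge0 U : U !=set0 -> (0 <= diameter U)%E.
Proof.
move=> [x Ux]; apply: (@le_trans _ _ (mdist x x)%:E); first by rewrite lee_fin mdist_ge0.
by apply: ereal_sup_ubound; exists x => //; exists x.
Qed.

Lemma diameter_real U (delta : R) : U !=set0 -> (diameter U <= delta%:E)%E ->
  diameter U = (fine (diameter U))%:E.
Proof.
move=> U0 Ud; rewrite fineK // ge0_fin_numE ?diameter_ge0 //.
by rewrite (le_lt_trans Ud) // ltry.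
Qed.

Lemma diameter_powE s U (delta : R) : U !=set0 -> (diameter U <= delta%:E)%E ->
  diameter_pow s U = (fine (diameter U) `^ s)%:E.
Proof.
move=> U0 Ud; rewrite /diameter_pow ifF; last first.
  by apply/negbTE/set0P.
by rewrite (diameter_real U0 Ud) poweR_EFin.
Qed.

Lemma diameter_pow_ge0 s U : (0 <= diameter_pow s U)%E.
Proof. by rewrite /diameter_pow; case: ifP => // _; exact: poweR_ge0. Qed.

Lemma hausdorff_premeasure_ge0 s delta A : (0 <= hausdorff_premeasure s delta A)%E.
Proof.
apply: le_ereal_inf_tmp => _ [U _ <-]; apply: nneseries_ge0 => i _ _.
exact: diameter_pow_ge0.
Qed.

(** A vanishing s-measure with s < d would give covers of A of arbitrarily small cost, against the
    lower bound c0 for ball covers at a larger exponent sigma < d. *)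
Lemma hausdorff_dim_ge A :
  (forall sigma : R, 0 <= sigma < d%:R -> exists2 c0 : R, 0 < c0 &
    forall (c : nat -> torus) (rad : nat -> R),
    (forall i, 0 < rad i <= (8 * d%:R)^-1) ->
    (forall x, A x -> exists i, torus_dist (c i) x < rad i) ->
    exists n, c0 <= \sum_(i < n) rad i `^ sigma) ->
  ((d%:R)%:E <= hausdorff_dim A)%E.
Proof.
move=> hA; apply: le_ereal_inf_tmp => _ [s [s0 Hs0] <-]; rewrite lee_fin leNgt.
(* Strictly between [s] and [d]: with exponent [sigma > 0] the covering sets,
   which may be points, can be enlarged to balls at an arbitrarily small cost. *)
apply/negP => sd; pose sigma := (s + d%:R) / 2.
have dr : 0 < d%:R :> R by rewrite ltr0n.
have sig_gt0 : 0 < sigma by rewrite /sigma; lra.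
have sig_s : s < sigma by rewrite /sigma; lra.
have [|c0 c00 hc] := hA sigma; first by rewrite ltW //= /sigma; lra.
(* Radii will be at most 2 delta = 1 / (8 d), as the assumed bound on covers demands. *)
pose delta : R := (16 * d%:R)^-1.
have delta0 : 0 < delta by rewrite invr_gt0 mulr_gt0.
have delta1 : delta <= 1.
  by rewrite invf_le1 ?mulr_gt0 // -natrM ler1n muln_gt0.
have P2 : 0 < 2 `^ sigma :> R by rewrite powR_gt0.
(* Diameters and enlargements each cost at most eps, for a total of at most 2^sigma * 2 eps < c0. *)
pose eps := c0 / (2 `^ sigma * 4).
have eps0 : 0 < eps by rewrite divr_gt0 // mulr_gt0.
have : (hausdorff_premeasure s delta A < eps%:E)%E.
  apply: (@le_lt_trans _ _ 0%E); last by rewrite lte_fin.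
  by rewrite -Hs0; apply: ereal_sup_ubound; exists delta.
case/ereal_inf_lt => _ [U [AU Udelta] <-] Usum.
(* Positive lower bounds for the radii, with sigma-powers summing to at most eps. *)
pose t i : R := Num.min delta ((eps * 2^-1 ^+ i.+1) `^ sigma^-1).
have t0 i : 0 < t i.
  by rewrite lt_min delta0 powR_gt0 // mulr_gt0 // exprn_gt0.
have tpow i : t i `^ sigma <= eps * 2^-1 ^+ i.+1.
  have e0 : 0 <= eps * 2^-1 ^+ i.+1 by rewrite mulr_ge0 ?exprn_ge0 // ltW.
  apply: (@le_trans _ _ (((eps * 2^-1 ^+ i.+1) `^ sigma^-1) `^ sigma)).
    apply: ge0_ler_powR; rewrite ?nnegrE ?powR_ge0 //; try exact: ltW.
    by rewrite ge_min lexx orbT.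
  by rewrite -powRrM mulVf ?powRr1 // gt_eqF.
pose D i : R := if U i == set0 then 0 else fine (diameter (U i)).
have UD i x y : U i x -> U i y -> torus_dist x y <= D i.
  move=> Ux Uy; rewrite /D ifF; last by apply/negbTE/set0P; exists x.
  rewrite -lee_fin -(diameter_real _ (Udelta i)); last by exists x.
  by apply: ereal_sup_ubound; exists x => //; exists y.
have D0 i : 0 <= D i.
  rewrite /D; case: ifPn => // /set0P U0.
  by rewrite -lee_fin -(diameter_real U0 (Udelta i)) diameter_ge0.
have Dd i : D i <= delta.
  rewrite /D; case: ifPn => [_|/set0P U0]; first exact: ltW.
  by rewrite -lee_fin -(diameter_real U0 (Udelta i)).
have DU i : ((D i `^ sigma)%:E <= diameter_pow s (U i))%E.
  rewrite /D; have [->|/set0P U0] := eqVneq (U i) set0.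
    by rewrite powR0 ?gt_eqF // diameter_pow_ge0.
  rewrite (diameter_powE s U0 (Udelta i)) lee_fin.
  have Di := D0 i; have Di' := Dd i; rewrite /D ifF in Di Di'; last exact/negbTE/set0P.
  set x := fine _ in Di Di' *.
  have [->|x0] := eqVneq x 0; first by rewrite powR0 ?gt_eqF // powR_ge0.
  apply: ger_powR; last exact: ltW.
  by rewrite lt_neqAle eq_sym x0 Di (le_trans Di').
pose c i : torus := if pselect (U i !=set0) is left h then projT1 (cid h) else \pi_torus 0.
(* The factor 2 makes the inclusion in the open ball strict. *)
pose rad i := 2 * Num.max (D i) (t i).
have radle i : rad i `^ sigma <= 2 `^ sigma * (D i `^ sigma + t i `^ sigma).
  have m0 : 0 <= Num.max (D i) (t i) by rewrite le_max D0.
  rewrite /rad (powRM _ _ m0) // ler_pM2l //.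
  have hD := powR_ge0 (D i) sigma; have ht := powR_ge0 (t i) sigma.
  by case: (leP (D i) (t i)) => _; rewrite ?lerDl ?lerDr.
have [i|x Ax|n] := hc c rad.
- rewrite mulr_gt0 ?lt_max ?t0 ?orbT //=.
  have -> : (8 * d%:R)^-1 = 2 * delta :> R by rewrite /delta; field; rewrite gt_eqF.
  by rewrite ler_pM2l // ge_max Dd ge_min lexx.
- have [i _ Uix] := AU x Ax; exists i.
  rewrite /c; case: pselect => [h|]; last by case; exists x.
  apply: (le_lt_trans (UD i _ _ (projT2 (cid h)) Uix)).
  have : D i <= Num.max (D i) (t i) by rewrite le_max lexx.
  have : 0 < Num.max (D i) (t i) by rewrite lt_max t0 orbT.
  rewrite /rad; lra.
apply/negP; rewrite -ltNge.
have h1 : \sum_(i < n) D i `^ sigma < eps.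
  rewrite -lte_fin; apply: le_lt_trans Usum.
  apply: le_trans (nneseries_lim_ge n _) => [|i _ _]; last exact: diameter_pow_ge0.
  rewrite big_mkord -sumEFin; apply: lee_sum => i _; exact: DU.
have h2 : \sum_(i < n) t i `^ sigma <= eps.
  apply: (@le_trans _ _ (eps * (1 - 2^-1 ^+ n))).
    have -> : 1 - 2^-1 ^+ n = \sum_(i < n) 2^-1 ^+ i.+1 :> R.
      elim: (n) => [|m IH]; first by rewrite big_ord0 expr0 subrr.
      by rewrite big_ord_recr /= -IH !exprS; field.
    by rewrite mulr_sumr; apply: ler_sum => i _; exact: tpow.
  by rewrite -[leRHS]mulr1 ler_pM2l // gerBl exprn_ge0.
apply: (@le_lt_trans _ _ (2 `^ sigma * (\sum_(i < n) D i `^ sigma + \sum_(i < n) t i `^ sigma))).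
  by rewrite -big_split mulr_sumr /=; apply: ler_sum => i _; exact: radle.
have -> : c0 = 2 `^ sigma * (4 * eps) by rewrite /eps; field; rewrite gt_eqF.
rewrite ltr_pM2l //; lra.
Qed.

(** * Covers by cubes of side 1/N and the upper bound for the dimension *)

Section Cubes.
Variable N : nat.
Hypothesis N0 : (0 < N)%N.

Definition cube (l : {ffun 'I_d -> 'I_N}) : set torus :=
  [set y | exists2 v, \pi_torus v = y &
    forall i, (l i)%:R / N%:R <= v i 0 <= ((l i)%:R + 1) / N%:R].

Lemma cube_dist l x y : cube l x -> cube l y -> torus_dist x y <= N%:R^-1.
Proof.
move=> [v <- hv] [v' <- hv']; rewrite (le_trans (torus_dist_pi _ _)) //.
rewrite [leLHS]mx_normrE; apply/bigmax_leP; split=> [|[i k] _ /=]; first by rewrite invr_ge0.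
rewrite (ord1 k) !mxE; have /andP[a1 a2] := hv i; have /andP[b1 b2] := hv' i.
move: a2 b2; rewrite !mulrDl mul1r ler_norml => a2 b2; apply/andP; split; lra.
Qed.

Lemma cube_cover x : exists l, cube l x.
Proof.
pose fr i : R := repr x i 0 - (Num.floor (repr x i 0))%:~R.
have fr0 i : 0 <= fr i by rewrite subr_ge0 floor_le.
have fr1 i : fr i < 1.
  by rewrite ltrBlDl -[1]/(1%:~R) -intrD floorD1_gt.
have Nr : 0 < N%:R :> R by rewrite ltr0n.
have frN i : 0 <= fr i * N%:R by rewrite mulr_ge0.
have lN i : (Num.truncn (fr i * N%:R) < N)%N.
  rewrite -(ltr_nat R); apply: (@le_lt_trans _ _ (fr i * N%:R)).
    by rewrite truncn_le.
  by rewrite gtr_pMl.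
exists [ffun i => Ordinal (lN i)]; exists (\col_i fr i).
  rewrite -[RHS]reprK; apply/torus_piP/forallP => i.
  by rewrite !mxE addrAC subrr add0r rpredN intr_int.
move=> i; rewrite ffunE mxE /=; apply/andP; split.
  by rewrite ler_pdivrMr // truncn_le.
by rewrite ler_pdivlMr // natr1; apply: ltW; exact: truncnS_gt.
Qed.

End Cubes.

Lemma hausdorff_premeasure_le A (s delta : R) N : 0 <= s -> (0 < N)%N ->
  N%:R^-1 <= delta ->
  (hausdorff_premeasure s delta A <= (N%:R ^+ d * (N%:R^-1 `^ s))%:E)%E.
Proof.
move=> s0 N0 Nd.
pose es := enum {ffun 'I_d -> 'I_N}.
(* The N^d cubes in enumeration order, padded by empty sets that cost nothing. *)
pose U i := if (i < size es)%N then cube (nth [ffun=> Ordinal N0] es i) else set0.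
apply: (@le_trans _ _ (\sum_(0 <= i <oo) diameter_pow s (U i))%E).
  apply: ereal_inf_lbound; exists U => //; split.
    move=> x _; have [l lx] := cube_cover N0 x.
    exists (index l es) => //; rewrite /U index_mem mem_enum /= nth_index //.
    by rewrite mem_enum.
  move=> i; apply: ge_ereal_sup => _ [x Ux [y Uy <-]].
  move: Ux Uy; rewrite /U; case: ifP => // _ Ux Uy.
  by rewrite lee_fin (le_trans (cube_dist Ux Uy)).
have term i : (diameter_pow s (U i) <= ((i < size es)%N%:R * N%:R^-1 `^ s)%:E)%E.
  rewrite /U; case: ifP => _; last by rewrite /diameter_pow eqxx mul0r.
  set Q := cube _; rewrite mul1r.
  have [->|/set0P Q0] := eqVneq Q set0.
    by rewrite /diameter_pow eqxx lee_fin powR_ge0.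
  have QN : (diameter Q <= (N%:R^-1)%:E)%E.
    by apply: ge_ereal_sup => _ [x Ux [y Uy <-]]; rewrite lee_fin (cube_dist Ux Uy).
  rewrite (diameter_powE s Q0 QN) lee_fin; apply: ge0_ler_powR => //.
  - by rewrite nnegrE -lee_fin -(diameter_real Q0 QN) diameter_ge0.
  - by rewrite nnegrE invr_ge0.
  - by rewrite -lee_fin -(diameter_real Q0 QN).
apply: lime_le; first by apply: is_cvg_nneseries => i _ _; exact: diameter_pow_ge0.
apply: nearW => m; apply: (@le_trans _ _ (\sum_(0 <= i < m) ((i < size es)%N%:R * N%:R^-1 `^ s)%:E)%E).
  by apply: lee_sum => i _; exact: term.
rewrite sumEFin lee_fin -mulr_suml ler_wpM2r ?powR_ge0 //.
have -> : N%:R ^+ d = (size es)%:R :> R.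
  by rewrite -cardE card_ffun !card_ord natrX.
rewrite -natr_sum ler_nat.
elim: m => [|m IH]; first by rewrite big_geq.
have h k : (\sum_(0 <= i < k) (i < size es) <= minn k (size es))%N.
  elim: k => [|k IHk]; first by rewrite big_geq.
  rewrite big_nat_recr //= (leq_trans (leq_add IHk (leqnn _))) //.
  by clear; case: (ltnP k (size es)) => /=; lia.
by rewrite (leq_trans (h m.+1)) // geq_minr.
Qed.

(** At exponent d + e the cubes cost N^d N^-(d + e) = N^-e, which tends to 0. *)
Lemma hausdorff_dim_le A : (hausdorff_dim A <= (d%:R)%:E)%E.
Proof.
apply/lee_addgt0Pr => e e0; rewrite -EFinD.
apply: ereal_inf_lbound; exists (d%:R + e) => //; split.
  by rewrite addr_ge0 // ltW.
apply/eqP; rewrite eq_le; apply/andP; split; last first.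
  apply: le_trans (hausdorff_premeasure_ge0 (d%:R + e) 1 A) _.
  by apply: ereal_sup_ubound; exists 1 => //=.
apply: ge_ereal_sup => _ [delta /= delta0 <-].
apply/lee_addgt0Pr => eta eta0; rewrite add0e.
pose N := (Num.truncn (Num.max delta^-1 (eta^-1 `^ e^-1))).+1.
have Nlt : Num.max delta^-1 (eta^-1 `^ e^-1) < N%:R by exact: truncnS_gt.
move: Nlt; rewrite gt_max => /andP[N1 N2].
have Nr : 0 < N%:R :> R by rewrite ltr0n.
apply: le_trans (hausdorff_premeasure_le A (s := d%:R + e) (N := N) _ _ _) _ => //.
- by rewrite addr_ge0 // ltW.
- by rewrite -[delta]invrK lef_pV2 ?posrE ?invr_gt0 // ltW.
rewrite lee_fin.
have -> : N%:R ^+ d * N%:R^-1 `^ (d%:R + e) = (N%:R `^ e)^-1 :> R.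
  have Nr0 : N%:R != 0 :> R by rewrite gt_eqF.
  rewrite -powR_inv1 ?(ltW Nr) // -powRrM mulN1r powRN powRD ?Nr0 ?implybT //.
  by rewrite powR_mulrn ?(ltW Nr) // invfM mulrA mulfV ?mul1r // expf_neq0.
rewrite -[eta]invrK lef_pV2 ?posrE ?powR_gt0 ?invr_gt0 //.
have -> : eta^-1 = (eta^-1 `^ e^-1) `^ e.
  by rewrite -powRrM mulVf ?gt_eqF // powRr1 // invr_ge0 ltW.
apply: ge0_ler_powR; rewrite ?nnegrE ?powR_ge0 //; exact: ltW.
Qed.

End HausdorffTorus.

(** * Polynomial growth of matrix powers *)

Section PolynomialGrowth.
Variables (R : realType) (m : nat) (A : 'M[R[i]]_m.+1).

(* Peeling the factors off a product of [A - z] annihilating [Y], one gains a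
   power of [n] for each eigenvalue [z] of modulus at most one. *)
Lemma annihilated_growth (s : seq R[i]) (Y : 'M[R[i]]_m.+1) :
  (forall z, z \in s -> normc z <= 1) ->
  horner_mx A (\prod_(z <- s) ('X - z%:P)) * Y = 0 ->
  exists2 C : R, 0 <= C & forall n i j,
    normc ((A ^+ n * Y) i j) <= C * n.+1%:R ^+ size s.
Proof.
elim: s Y => [|z s IH] Y zs.
  rewrite big_nil rmorph1 mul1r => ->; exists 0 => // n i j.
  by rewrite mulr0 mxE ComplexField.Normc.normc0 mul0r.
rewrite big_cons mulrC rmorphM -mulrA => hY.
have [|C C0 hC] := IH (horner_mx A ('X - z%:P) * Y) _ hY.
  by move=> x xs; apply: zs; rewrite inE xs orbT.
have z1 : normc z <= 1 by apply: zs; rewrite inE eqxx.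
pose C1 := \sum_i \sum_j normc (Y i j).
have C10 : 0 <= C1 by apply: sumr_ge0 => i _; apply: sumr_ge0 => j _; exact: normc_ge0.
exists (C1 + C); first exact: addr_ge0.
elim=> [|n IHn] i j.
  rewrite expr0 mul1r expr1n mulr1.
  have : normc (Y i j) <= C1.
    rewrite /C1 (bigD1 i) //= (bigD1 j) //= -addrA lerDl addr_ge0 // sumr_ge0 // => *.
      exact: normc_ge0.
    by apply: sumr_ge0 => *; exact: normc_ge0.
  lra.
(* The first term does not expand since |z| <= 1; the second grows with one power less because the
   remaining factors annihilate (A - z) Y. *)
have -> : A ^+ n.+1 * Y = z *: (A ^+ n * Y) + A ^+ n * (horner_mx A ('X - z%:P) * Y).
  rewrite rmorphB /= horner_mx_X horner_mx_C mulrBl mulrBr mulrA -exprSr.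
  rewrite addrCA; apply/esym/eqP; rewrite -subr_eq0 addrAC subrr add0r; apply/eqP.
  by rewrite -[z%:M * Y]/(z%:M *m Y) mul_scalar_mx scalerAr subrr.
rewrite mxE (le_trans (ler_normcD _ _)) // mxE ComplexField.Normc.normcM.
have h1 := IHn i j; have h2 := hC n i j.
have h3 : normc z * normc ((A ^+ n * Y) i j) <= 1 * normc ((A ^+ n * Y) i j).
  by rewrite ler_wpM2r ?normc_ge0.
set p := n.+1%:R ^+ size s in h2 *.
have p0 : 0 <= p by rewrite exprn_ge0.
have h4 : (C1 + C) * ((n.+1%:R + 1) * p) <= (C1 + C) * n.+2%:R ^+ (size s).+1.
  rewrite ler_wpM2l ?addr_ge0 // exprS natr1 ler_wpM2l //.
  by apply: lerXn2r; rewrite ?nnegrE // ler_nat.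
have h5 : 0 <= C1 * p by rewrite mulr_ge0.
rewrite /= in h1 *; rewrite exprS -/p in h1.
move: h1 h2 h3 h4; lra.
Qed.

(** The characteristic polynomial splits over the complex numbers and, by Cayley-Hamilton,
    annihilates Y = 1. *)
Lemma power_growth : (forall z, eigenvalue A z -> normc z <= 1) ->
  exists2 C : R, 0 <= C & forall n i j, normc ((A ^+ n) i j) <= C * n.+1%:R ^+ m.+1.
Proof.
move=> hz; have [s hs] := closed_field_poly_normal (char_poly A).
have := char_poly_monic A; rewrite monicE => /eqP lc; rewrite lc scale1r in hs.
have szs : size s = m.+1.
  have := size_char_poly A; rewrite hs size_prod_XsubC => -[].
  by [].
have [||C C0 hC] := @annihilated_growth s 1.
- move=> z zs; apply: hz; rewrite eigenvalue_root_char hs root_prod_XsubC //.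
- by rewrite -hs Cayley_Hamilton mul0r.
by exists C => // n i j; have := hC n i j; rewrite mulr1 szs.
Qed.

End PolynomialGrowth.

(** * Zero entropy in the absence of an expanding eigenvalue *)

Section ZeroEntropy.
Variables (R : realType) (m : nat) (B : 'M[int]_m.+1) (b : 'cV[R]_m.+1).
Local Notation torus := (torus R m.+1).
Local Notation T := (torus_affine B b).
Local Notation BR := (map_mx (intr : int -> R) B).
(** Transposed because [eigenvalue] refers to row vectors: a row eigenvector of A is a column
    eigenvector of B. *)
Local Notation A := ((map_mx (intr : int -> R[i]) B)^T).
Hypothesis A_spectrum : forall z, eigenvalue A z -> normc z <= 1.

Lemma iter_linear_growth : exists2 C : R, 0 <= C & forall n (x : 'cV[R]_m.+1),
  `|iter n (mulmx BR) x| <= C * n.+1%:R ^+ m.+1 * `|x|.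
Proof.
have [C C0 hC] := power_growth A_spectrum.
exists (m.+1%:R * C); first by rewrite mulr_ge0.
move=> n x.
have rowE : (map_mx (real_complex R) (iter n (mulmx BR) x))^T
    = (map_mx (real_complex R) x)^T *m (A ^+ n).
  elim: n => [|n IH] /=; first by rewrite expr0 mulmx1.
  rewrite map_mxM trmx_mul IH exprSr -mulmxA; congr (_ *m (_ *m _)).
  by apply/matrixP => i j; rewrite !mxE /= rmorph_int.
rewrite [leLHS]mx_normrE; apply/bigmax_leP; split=> [|[i k] _ /=].
  by rewrite !mulr_ge0 // exprn_ge0.
rewrite (ord1 k) -normc_real.
have -> : ((iter n (mulmx BR) x) i 0)%:C
    = ((map_mx (real_complex R) (iter n (mulmx BR) x))^T) 0 i by rewrite !mxE.
rewrite rowE mxE (le_trans (normc_sum _ _ _)) //.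
apply: (@le_trans _ _ (\sum_(j < m.+1) (C * n.+1%:R ^+ m.+1 * `|x|))).
  apply: ler_sum => j _; rewrite !mxE ComplexField.Normc.normcM normc_real mulrC.
  by rewrite ler_pM ?normc_ge0 // mx_coord_le.
by rewrite sumr_const card_ord -[leLHS]mulr_natl !mulrA.
Qed.

Lemma torus_iterE n v : iter n T (\pi_torus v) = \pi_torus (iter n (fun y => BR *m y + b) v).
Proof. by elim: n => // n IH; rewrite !iterS IH torus_affineE. Qed.

Lemma affine_iterB n (v v' : 'cV[R]_m.+1) :
  iter n (fun y => BR *m y + b) v - iter n (fun y => BR *m y + b) v'
  = iter n (mulmx BR) (v - v').
Proof.
elim: n => // n IH; rewrite !iterS -IH mulmxBr opprD addrACA subrr addr0 //.
Qed.

(** Two points of one cube of side 1/N stay within C n^(m+1) / N <= eps during n steps, so a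
    separated set has at most one point in each cube. *)
Lemma separated_card_le : exists2 C : R, 0 <= C & forall n (eps : R) N, (0 < n)%N ->
  0 < eps -> (0 < N)%N -> C * n%:R ^+ m.+1 <= eps * N%:R ->
  (separated_card T n eps <= ((N ^ m.+1)%:R)%:E)%E.
Proof.
have [C C0 hC] := iter_linear_growth.
exists C => // n eps N n0 eps0 N0 hN.
apply: ge_ereal_sup => _ [E sepE <-]; rewrite lee_fin ler_nat.
have Nr : 0 < N%:R :> R by rewrite ltr0n.
pose l (x : torus) := projT1 (cid (cube_cover N0 x)).
have lP x : cube (l x) x := projT2 (cid (cube_cover N0 x)).
have linj : {in E &, injective l}.
  move=> x y xE yE lxy; apply/eqP/negPn/negP => xy.
  have := sepE x y xE yE xy; apply/negP; rewrite -leNgt.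
  apply/bigmax_leP; split => [|i _]; first exact: ltW.
  have := lP x; rewrite lxy => -[v vx hv]; have [v' v'y hv'] := lP y.
  rewrite -vx -v'y !torus_iterE.
  apply: (le_trans (torus_dist_pi _ _)); rewrite affine_iterB.
  rewrite (le_trans (hC i _)) //.
  have vv' : `|v - v'| <= N%:R^-1.
    rewrite [leLHS]mx_normrE; apply/bigmax_leP; split=> [|[k k'] _ /=]; first by rewrite invr_ge0.
    rewrite (ord1 k') !mxE; have /andP[a1 a2] := hv k; have /andP[b1 b2] := hv' k.
    move: a2 b2; rewrite !mulrDl mul1r ler_norml => a2 b2; apply/andP; split; lra.
  apply: (@le_trans _ _ (C * n%:R ^+ m.+1 * N%:R^-1)).
    rewrite ler_pM ?mulr_ge0 ?exprn_ge0 // ler_wpM2l // lerXn2r ?nnegrE //.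
    by rewrite ler_nat.
  by rewrite ler_pdivrMr.
have -> : (N ^ m.+1)%N = size (enum {ffun 'I_m.+1 -> 'I_N}).
  by rewrite -cardE card_ffun !card_ord.
rewrite -(size_map l); apply: uniq_leq_size.
  by rewrite map_inj_in_uniq // fset_uniq.
by move=> z _; rewrite mem_enum.
Qed.

Lemma separated_card_ge1 n (eps : R) : (1 <= separated_card T n eps)%E.
Proof.
apply: ereal_sup_ubound; exists [fset (\pi_torus 0 : torus)]%fset; last by rewrite cardfs1.
by move=> x y; rewrite !inE => /eqP -> /eqP ->; rewrite eqxx.
Qed.

(** A number N of order n^(m+1) is admissible in [separated_card_le], so the logarithm of the
    cardinality is O(log n), which is negligible against n. *)
Lemma entropy_at0 (eps : R) : 0 < eps -> entropy_at T eps = 0%E.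
Proof.
move=> eps0; apply/eqP; rewrite eq_le; apply/andP; split; last first.
  apply: limn_esup_ge => N0; exists N0 => //.
  apply: mule_ge0; first by rewrite lee_fin invr_ge0.
  by rewrite lne_ge0 separated_card_ge1.
have [C C0 hC] := separated_card_le.
apply/lee_addgt0Pr => e e0; rewrite add0e.
pose D : R := m.+1%:R.
have D0 : 0 < D by rewrite ltr0n.
(* The 1 makes C' n^(m+1) at least 1, so that rounding it up at most doubles it. *)
pose C' : R := C / eps + 1.
have C'1 : 1 <= C' by rewrite /C' lerDr divr_ge0 // ltW.
have C'0 : 0 < C' := lt_le_trans ltr01 C'1.
(* Chosen so that D^2 delta = e / 2; the linear bound on ln n comes from ln y < y at y = delta n. *)
pose delta : R := e / (2 * D * D).
have delta0 : 0 < delta by rewrite divr_gt0 // !mulr_gt0.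
pose c : R := D * (ln (2 * C') + D * `|ln delta|).
have bound n : (0 < n)%N -> (lne (separated_card T n eps) <= (c + e / 2 * n%:R)%:E)%E.
  move=> n0; have nr : 1 <= n%:R :> R by rewrite ler1n.
  pose N := (Num.truncn (C' * n%:R ^+ m.+1)).+1.
  have np : 1 <= n%:R ^+ m.+1 :> R by rewrite exprn_ege1.
  have hN1 : C' * n%:R ^+ m.+1 < N%:R by exact: truncnS_gt.
  have hN2 : N%:R <= 2 * C' * n%:R ^+ m.+1.
    rewrite /N -natr1.
    have : (Num.truncn (C' * n%:R ^+ m.+1))%:R <= C' * n%:R ^+ m.+1.
      by rewrite truncn_le // mulr_ge0 ?(ltW C'0) // exprn_ge0.
    have : 1 * 1 <= C' * n%:R ^+ m.+1 by rewrite ler_pM.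
    lra.
  have Nr : 0 < N%:R :> R by rewrite ltr0n.
  have sep : (separated_card T n eps <= ((N ^ m.+1)%:R)%:E)%E.
    apply: hC => //.
    have h : C * n%:R ^+ m.+1 <= eps * (C' * n%:R ^+ m.+1).
      rewrite mulrA ler_wpM2r ?exprn_ge0 // /C' mulrDr mulr1 mulrCA mulfV ?gt_eqF //.
      by rewrite mulr1 lerDl ltW.
    by rewrite (le_trans h) // ler_pM2l // ltW.
  have sep1 := separated_card_ge1 n eps.
  apply: (@le_trans _ _ (lne ((N ^ m.+1)%:R)%:E)).
    rewrite lee_lne // in_itv /= leey andbT.
      by rewrite (le_trans _ sep1) // lee_fin.
    by rewrite lee_fin.
  rewrite lne_EFin ?ltr0n ?expn_gt0 // lee_fin natrX.
  have lnX (y : R) k : 0 < y -> ln (y ^+ k) = k%:R * ln y.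
    move=> y0; elim: k => [|k IH]; first by rewrite expr0 ln1 mul0r.
    by rewrite exprS lnM ?posrE ?exprn_gt0 // IH -natr1 mulrDl mul1r addrC.
  have n00 : 0 < n%:R :> R by rewrite ltr0n.
  have lnn : ln n%:R <= delta * n%:R + `|ln delta|.
    have -> : ln n%:R = ln (delta * n%:R) - ln delta.
      by rewrite lnM ?posrE // addrAC subrr add0r.
    apply: lerD; first by rewrite ltW // ln_sublinear // mulr_gt0.
    by rewrite -normrN ler_norm.
  rewrite lnX // -/D.
  have lnN : ln N%:R <= ln (2 * C') + D * ln n%:R.
    rewrite -lnX // -lnM ?posrE ?mulr_gt0 ?exprn_gt0 //.
    by rewrite ler_ln ?posrE ?mulr_gt0 ?exprn_gt0.
  have h1 : D * ln N%:R <= D * (ln (2 * C') + D * ln n%:R) by rewrite ler_pM2l.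
  have h2 : D * (D * ln n%:R) <= D * (D * (delta * n%:R + `|ln delta|)) by rewrite !ler_pM2l.
  have h3 : D * D * delta = e / 2 by rewrite /delta; field; rewrite gt_eqF.
  have h4 : D * D * delta * n%:R = e / 2 * n%:R by rewrite h3.
  rewrite /c; lra.
pose N1 := (Num.truncn (`|c| / (e / 2))).+1.
apply: (@le_trans _ _ (ereal_sup [set ((n%:R^-1)%:E * lne (separated_card T n eps))%E
    | n in [set n | (N1 <= n)%N]])).
  by apply: ereal_inf_lbound; exists [set n | (N1 <= n)%N] => //; exists N1.
apply: ge_ereal_sup => _ [n /= nN <-].
have n0 : (0 < n)%N by rewrite (leq_trans _ nN).
have nr : 0 < n%:R :> R by rewrite ltr0n.
apply: (@le_trans _ _ ((n%:R^-1)%:E * (c + e / 2 * n%:R)%:E)%E).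
  by apply: lee_wpmul2l; [rewrite lee_fin invr_ge0 | exact: bound].
rewrite -EFinM lee_fin ler_pdivrMl // [n%:R * e]mulrC.
have : `|c| / (e / 2) < n%:R.
  by rewrite (lt_le_trans (truncnS_gt _)) // ler_nat.
rewrite ltr_pdivrMr ?divr_gt0 // => h.
have := ler_norm c; lra.
Qed.

Lemma topological_entropy0 : topological_entropy T = 0%E.
Proof.
apply/cvg_lim => //; apply: cvg_near_cst.
by apply: filterS (nbhs_right_gt (0 : R)) => eps eps0; rewrite entropy_at0.
Qed.

End ZeroEntropy.

(** * From positive entropy to full dimension and Bohr chaos *)

Lemma expanding_eigenvector (R : realType) m (B : 'M[int]_m.+1) (b : 'cV[R]_m.+1) :
  (0 < topological_entropy (torus_affine B b))%E ->
  exists (lam : R[i]) (u : 'I_m.+1 -> R[i]) (i0 : 'I_m.+1),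
    [/\ forall i, \sum_j (B i j)%:~R * u j = lam * u i, u i0 = 1 & 1 < normc lam].
Proof.
move=> h; apply: contrapT => hn; move: h.
rewrite topological_entropy0 ?ltxx // => z /eigenvalueP[v hv v0].
rewrite leNgt; apply/negP => z1; apply: hn.
have [i0 vi0] : exists i0, v 0 i0 != 0.
  apply/existsP; apply: contraR v0 => /existsPn hv0.
  by apply/eqP/rowP => i; rewrite mxE; apply/eqP; move: (hv0 i); rewrite negbK.
exists z, (fun j => v 0 j / v 0 i0), i0; split => //; last by rewrite mulfV.
move=> i; have := congr1 (fun M : 'rV_m.+1 => M 0 i / v 0 i0) hv; rewrite !mxE mulrA => <-.
by rewrite mulr_suml; apply: eq_bigr => j _; rewrite !mxE mulrA [_%:~R * _]mulrC.
Qed.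

(** Serves to extract a correlated point from the full dimension d >= 1. *)
Lemma hausdorff_dim_set0 (R : realType) (d : nat) :
  (hausdorff_dim (set0 : set (torus R d)) <= 0)%E.
Proof.
apply: ereal_inf_lbound; exists 0 => //; split => //.
apply/eqP; rewrite eq_le; apply/andP; split; last first.
  apply: le_trans (hausdorff_premeasure_ge0 0 1 set0) _.
  by apply: ereal_sup_ubound; exists 1 => //=.
apply: ge_ereal_sup => _ [delta /= delta0 <-].
apply: ereal_inf_lbound; exists (fun=> set0); last first.
  by apply: eseries0 => i _ _; rewrite /diameter_pow eqxx.
split => // i; apply: ge_ereal_sup => _ [x []].
Qed.

Theorem theorem1p2 (R : realType) (d : nat) (B : 'M[int]_d) (b : 'cV[R]_d) :
  (1 <= d)%N -> \det B != 0 ->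
  (0 < topological_entropy (torus_affine B b))%E ->
  bohr_chaotic (torus_affine B b) /\
  forall w : nat -> R[i], nontrivial_weight w ->
    exists f : torus R d -> R[i]^o,
      continuous f /\
      hausdorff_dim [set x | correlated (torus_affine B b) w f x] = (d%:R)%:E.
Proof.
case: d B b => // m B b _ _ h.
have [lam [u [i0 [hu u1 lam1]]]] := expanding_eigenvector h.
have full w : nontrivial_weight w ->
    hausdorff_dim [set x | correlated (torus_affine B b) w (@coord_chr R m.+1 i0) x]
    = (m.+1%:R)%:E.
  move=> hw; apply/eqP; rewrite eq_le hausdorff_dim_le //=.
  apply: hausdorff_dim_ge => // sigma hsigma.
  exact: (covering_content b hu u1 lam1 hw hsigma).
split => w hw; last first.
  by exists (@coord_chr R m.+1 i0); split; [exact: coord_chr_continuous | exact: full].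
exists (@coord_chr R m.+1 i0); split; first exact: coord_chr_continuous.
apply: contrapT => hx; have := full w hw.
have -> : [set x | correlated (torus_affine B b) w (@coord_chr R m.+1 i0) x] = set0.
  by apply/seteqP; split => // x cx; apply: hx; exists x.
move=> hd; have := hausdorff_dim_set0 R m.+1.
by rewrite hd lee_fin lern0.
Qed.
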